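(* Let $q$ be a prime power, $m\geq 2$ an integer, and let $\{A_1,\ldots,A_m\}$ be a set of $\mathbb{F}_q$-affine hyperplanes of $\mathbb{F}_{q^m}$ in general position. Put $S_c^* = \mathbb{F}_{q^m}\setminus\bigcup_{i=1}^m A_i$ and let $f(x)=ax^2+bx+c\in\mathbb{F}_{q^m}[x]$ with $a\neq 0$ and $b^2\neq 4ac$. Then there exists a primitive $S_c^*$ pair $(\alpha,f(\alpha))$ of $\mathbb{F}_{q^m}$, provided one of the following holds: (1) $m=2$ and $q>9.4718\times 10^{13}$; (2) $m=3$ and $q>6.601\times 10^{11}$; (3) $m=4$ and $q>1.271\times 10^{8}$.
   Context: $\mathbb{F}_{q^m}$ is regarded as an $m$-dimensional vector space over $\mathbb{F}_q$. A set $\{A_1,\ldots,A_m\}$ of $\mathbb{F}_q$-affine hyperplanes of $\mathbb{F}_{q^m}$ in general position is given as follows: for an $\mathbb{F}_q$-basis $\{\beta_1,\ldots,\beta_m\}$ of $\mathbb{F}_{q^m}$ and elements $c_1,\ldots,c_m\in\mathbb{F}_q$, $A_j=\{\sum_{i=1}^m a_i\beta_i : a_i\in\mathbb{F}_q,\ a_j=c_j\}$. (Then for $1\leq k\leq m$ the intersection of any $k$ distinct $A_j$ is an $\mathbb{F}_q$-affine space of dimension $m-k$.) An element of $\mathbb{F}_{q^m}$ is primitive if it generates the cyclic group $\mathbb{F}_{q^m}^*$. A primitive $S_c^*$ pair is a pair $(\alpha,f(\alpha))$ with $\alpha\in\mathbb{F}_{q^m}$ such that both $\alpha$ and $f(\alpha)$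 are primitive elements of $\mathbb{F}_{q^m}$ and both belong to $S_c^*$. *)

(* Defs.v *)
From HB Require Import structures.
From mathcomp Require Import all_boot all_order all_algebra all_fingroup
  all_solvable all_field.

Set Implicit Arguments.
Unset Strict Implicit.
Unset Printing Implicit Defensive.

Import GRing.Theory.
Local Open Scope ring_scope.

(* F plays the role of F_q and L that of F_{q^m}.  A fieldExtType over a
   finFieldType is not canonically a finType: [finvect_type L] is the library's
   alias of L that carries both the finite field structure and the F-algebra
   structure. *)

Definition affine_hyperplane (F : finFieldType) (L : fieldExtType F) (m : nat)
    (beta : m.-tuple L) (c : 'I_m -> F) (j : 'I_m) : {set finvect_type L} :=
  [set (\sum_(i < m) u i *: tnth beta i : finvect_type L)
     | u : {ffun 'I_m -> F} & u j == c j].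

Definition hyperplanes_in_general_position (F : finFieldType)
    (L : fieldExtType F) (m : nat) (A : 'I_m -> {set finvect_type L}) : Prop :=
  exists (beta : m.-tuple L) (c : 'I_m -> F),
    basis_of {:L} beta /\ forall j, A j = affine_hyperplane beta c j.

Definition Sc_star (F : finFieldType) (L : fieldExtType F) (m : nat)
    (A : 'I_m -> {set finvect_type L}) : {set finvect_type L} :=
  ~: \bigcup_(i < m) A i.

(* [FinRing.uval] is the inclusion of the unit group of K into K. *)
Definition primitive_element (K : finFieldType) (x : K) : Prop :=
  exists2 u : {unit K}, FinRing.uval u = x & generator [set: {unit K}] u.

Definition primitive_pair_in (K : finFieldType) (S : {set K}) (x y : K) : Prop :=
  [/\ primitive_element x, primitive_element y, x \in S & y \in S].

(* Main.v *)
(* No character sums are needed.  Since q is huge and m <= 4, the pairs meeting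
   one of the hyperplanes are a proportion at most 12 / q of all pairs, so it is
   enough to find more than 12 q^m / q primitive pairs.  With Q = q^m and a
   generator g of the multiplicative group, x = g^i and f(x) = g^j are primitive
   when i and j avoid 0 modulo every prime divisor of Q - 1.  The number of x
   with i, j in prescribed classes modulo d1 and d2 is bounded above, up to
   O(sqrt Q), by Q / (d1 d2): put x = s u^d1 and apply Stepanov's method to
   y^d2 = f(s u^d1), which is totally ramified at a root of the right-hand side
   because f has a simple nonzero root.  Adding up the classes gives the lower
   bound for the small primes dividing Q - 1, and the remaining primes are
   removed by a union bound. *)
Require Import Defs.
From mathcomp Require Import all_boot all_order all_algebra all_fingroup
  all_solvable all_field.
From mathcomp Require Import ring lra zify.

Set Implicit Arguments.
Unset Strict Implicit.
Unset Printing Implicit Defensive.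

Import Order.TTheory GRing.Theory Num.Theory.
Local Open Scope ring_scope.

(** * Stepanov's method *)

(** Stepanov's method gives only upper bounds. They turn into a lower bound because the total is
    known: the classes to be excluded are bounded above and subtracted from everything. The obstacle
    is the error. Treating [e] exactly costs about [25 * e ^ 2 * R] against a main term
    [(totient e / e) ^ 2 * R ^ 2], while the union bound needs the reciprocals of the remaining
    primes to sum to less than 1/2. So [e] must be small and still contain the small primes,
    although for m = 2 only R of order 9.4 * 10^13 is guaranteed. No fixed [e] serves every Q - 1,
    which may have many prime divisors; but many prime divisors force Q, hence R, to be large, and a
    larger R pays for a larger [e]. This trade-off produces three fixed cutoffs, and beyond them a
    choice of [e] with [e ^ 5 <= Q - 1], for which the error is controlled uniformly. *)

Lemma nonzero_solution (K : fieldType) (I J : finType) (a : I -> J -> K) :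
  (#|J| < #|I|)%N ->
  exists2 v : I -> K, exists i, v i != 0 & forall j, \sum_i v i * a i j = 0.
Proof.
move=> ltJI; pose A := \matrix_(i < #|I|, j < #|J|) a (enum_val i) (enum_val j).
have /rowV0Pn[u /sub_kermxP uA /rV0Pn[i0 ui0]] : kermx A != 0.
  by rewrite kermx_eq0 /row_free neq_ltn (leq_ltn_trans (rank_leq_col A)).
exists (fun i => u 0 (enum_rank i)); first by exists (enum_val i0); rewrite enum_valK.
move=> j; move/matrixP/(_ 0 (enum_rank j)): uA; rewrite !mxE => uAj.
rewrite -[RHS]uAj [RHS](reindex (@enum_rank I)); last first.
  by exists (@enum_val I I) => i _; rewrite ?enum_rankK ?enum_valK.
by apply: eq_bigr => i _; rewrite mxE !enum_rankK.
Qed.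

(** * Hasse derivatives and multiplicities of roots *)

Section Hasse.
Variable K : fieldType.
Implicit Types p q g c : {poly K}.

(** Leibniz rule. Hasse derivatives replace iterated ones because multiplicities up to [M] must be
    detected even when [M] exceeds the characteristic. *)
Lemma nderivnM n p q :
  (p * q)^`N(n) = \sum_(i < n.+1) p^`N(i) * q^`N(n - i).
Proof.
elim/poly_ind: p n => [|p c IHp] n.
  rewrite mul0r linear0 big1 // => i _.
  by rewrite linear0 mul0r.
case: n => [|n]; first by rewrite big_ord1 !nderivn0.
rewrite mulrDl mulrAC nderivnD mul_polyC nderivnZ.
have -> : p * q * 'X = p * q * 'X + 0%:P by rewrite addr0.
rewrite nderivnMXaddC !IHp [RHS]big_ord_recl nderivn0 subn0.
under [in RHS]eq_bigr => i _ do rewrite lift0 nderivnMXaddC subSS mulrDl.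
rewrite big_split /= mulrDl mul_polyC.
rewrite [X in _ + X * 'X]big_ord_recl nderivn0 subn0 /= mulrDl big_distrl /=.
set t := \sum_(i < n.+1) p^`N(bump 0 i) * _ * 'X.
have -> : t = \sum_(i < n.+1) p^`N(i.+1) * 'X * q^`N(n - i).
  by apply: eq_bigr => i _; rewrite mulrAC.
by ring.
Qed.

Lemma dvdp_sum (I : Type) (s : seq I) (P : pred I) (F : I -> {poly K}) p :
  (forall i, P i -> p %| F i) -> p %| \sum_(i <- s | P i) F i.
Proof. by move=> pF; apply: (big_ind (fun q => p %| q)) => //; exact: dvdp_add. Qed.

(** Split off one factor [g] and apply Leibniz: the term in which [g] is not differentiated keeps
    that factor, and in every other term at most [l - 1] derivatives fall on [c * g ^+ N]. For
    [l > N] the truncated exponent makes the divisor 1. *)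
Lemma dvdp_nderivn_exp g c N l : g ^+ (N - l) %| (c * g ^+ N)^`N(l).
Proof.
elim: N l => [|N IHN] l; first by rewrite sub0n expr0 dvd1p.
rewrite exprSr mulrA nderivnM; apply: dvdp_sum => i _.
have [->|nil] := eqVneq (i : nat) l.
  rewrite subnn nderivn0; have [leNl|ltNl] := leqP N.+1 l.
    by rewrite (eqP leNl) expr0 dvd1p.
  by rewrite subSn // exprSr; apply: dvdp_mul.
apply/dvdp_mulr/(dvdp_trans _ (IHN i))/dvdp_exp2l.
by move: nil (ltn_ord i) => /eqP; lia.
Qed.

Lemma size_nderivn p l : (size p^`N(l) <= size p - l)%N.
Proof. exact: size_poly. Qed.

Lemma dvdp_exp_XsubC_nderivn p (x : K) M :
  (forall l, (l < M)%N -> p^`N(l).[x] = 0) -> ('X - x%:P) ^+ M %| p.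
Proof.
move=> p0.
(* Taylor expansion of [p], lifted to coefficients in K[X], at the constant [x] with increment
   ['X - x]. *)
have := nderiv_taylor (map_poly polyC p) (mulrC x%:P ('X - x%:P)).
rewrite addrC subrK size_map_polyC => pE.
have -> : p = (map_poly polyC p).['X] by rewrite -[RHS]/(p \Po 'X) comp_polyXr.
rewrite pE; apply: dvdp_sum => i _; rewrite nderivn_map horner_map /=.
have [/p0 ->|leMi] := ltnP i M; first by rewrite mul0r dvdp0.
by rewrite dvdp_mull // dvdp_exp2l.
Qed.
End Hasse.

Lemma exprDn_pchar_poly (K : fieldType) (Q : nat) (u v : {poly K}) :
  [pchar K].-nat Q -> (u + v) ^+ Q = u ^+ Q + v ^+ Q.
Proof. by move=> KQ; rewrite exprDn_pchar // (eq_pnat _ (pchar_poly K)). Qed.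

Lemma dvdp_prod_XsubC_exp (K : fieldType) (S : seq K) (M : nat) (P : {poly K}) :
  uniq S -> (forall x, x \in S -> ('X - x%:P) ^+ M %| P) ->
  \prod_(x <- S) ('X - x%:P) ^+ M %| P.
Proof.
elim: S => [|x S IHS] /=; first by rewrite big_nil dvd1p.
case/andP=> xS uS PS; rewrite big_cons Gauss_dvdp; last first.
  apply/coprimep_expl; rewrite big_seq; apply: (big_ind (coprimep _)) => [|u v|y yS].
  - exact: coprimep1.
  - by rewrite coprimepMr => -> ->.
  - apply/coprimep_expr; rewrite coprimep_XsubC2 // subr_eq0.
    by apply: contraNneq xS => <-.
rewrite PS ?mem_head //= IHS // => y yS; apply: PS.
by rewrite inE yS orbT.
Qed.

(** * The auxiliary polynomial of Stepanov's method *)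

Section Stepanov.
Variables (K : fieldType) (Q B d k M n : nat) (g : {poly K}) (r z : K).
Hypothesis pQ : [pchar K].-nat Q.
Hypothesis dB : (d * B = Q.-1)%N.
Hypothesis sg : size g = n.+1.
Hypotheses (gr : root g r) (g'r : ~~ root g^`() r).

(* Since [d * B < Q], the supports [[E i, E i + B)] of the orders of vanishing
   at [r] of the summands are pairwise disjoint. *)
Lemma stepanov_independent (c : nat -> {poly K}) (i0 : nat) :
  (0 < d)%N -> (forall i, size (c i) <= B)%N -> (i0 < k * d)%N -> c i0 != 0 ->
  \sum_(i < k * d) c i * g ^+ (i %% d * B) * ('X - r%:P) ^+ (Q * (i %/ d)) != 0.
Proof.
move=> d_gt0 szc lti0 ci0.
have [g1 gE] : exists g1, g = g1 * ('X - r%:P) by apply/factor_theorem.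
have g1r : ~~ root g1 r.
  apply: contra g'r => g1r; rewrite gE derivM derivXsubC mulr1 /root hornerD.
  by rewrite hornerM !hornerE subrr mulr0 add0r.
pose E i := (i %% d * B + Q * (i %/ d))%N.
have Emon i j : (i < j)%N -> (E i + B <= E j)%N.
  move=> ltij; rewrite /E.
  have := leq_div2r d (ltnW ltij); rewrite leq_eqVlt => /orP[/eqP eqd|ltd].
    have ltm : (i %% d < j %% d)%N.
      by move: ltij; rewrite {1}(divn_eq i d) {1}(divn_eq j d) eqd ltn_add2l.
    by rewrite eqd addnAC leq_add2r addnC -mulSn leq_mul2r ltm orbT.
  have : ((i %% d).+1 * B <= d * B)%N by rewrite leq_mul2r ltn_pmod // orbT.
  have : (Q * (i %/ d).+1 <= Q * (j %/ d))%N by rewrite leq_mul2l ltd orbT.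
  by rewrite dB mulnS mulSn; lia.
have [i1 ci1 i1min] := ex_minnP (ex_intro (fun i => c i != 0) _ ci0).
have lti1 : (i1 < k * d)%N by apply: leq_ltn_trans (i1min _ ci0) lti0.
apply/negP => /eqP sum0.
pose X := 'X - r%:P.
have termE i : c i * g ^+ (i %% d * B) * X ^+ (Q * (i %/ d)) =
    c i * g1 ^+ (i %% d * B) * X ^+ E i.
  by rewrite gE exprMn /E exprD !mulrA.
have : X ^+ (E i1 + B) %| c i1 * g1 ^+ (i1 %% d * B) * X ^+ E i1.
  rewrite -termE.
  move: sum0; rewrite (bigD1 (Ordinal lti1)) //= => /eqP.
  rewrite addr_eq0 => /eqP ->; rewrite dvdpNr; apply: dvdp_sum => i nei.
  rewrite termE; have [ltii1|lei1i] := ltnP i i1.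
    have [->|/i1min] := eqVneq (c i) 0; first by rewrite !mul0r dvdp0.
    by rewrite leqNgt ltii1.
  apply/dvdp_mull/dvdp_exp2l/Emon; rewrite ltn_neqAle lei1i andbT.
  by apply: contraNneq nei => i1i; apply/eqP/val_inj.
rewrite addnC exprD dvdp_mul2r ?expf_neq0 ?polyXsubC_eq0 //.
(* The root [r] is simple, so [g1] is prime to [X]. Hence [X ^+ B] would divide the first nonzero
   [c i1], whose degree is below [B]. *)
rewrite Gauss_dvdpl; last first.
  by apply/coprimep_expl/coprimep_expr; rewrite coprimep_sym coprimep_XsubC.
move/(dvdp_leq ci1); rewrite size_exp_XsubC => /leq_trans/(_ (szc i1)).
by rewrite ltnn.
Qed.

(** What remains of the derivative after its forced factor is removed. Its degree is at most
    [a + l * n.-1], independent of the huge exponent [N], which keeps the number of linear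
    conditions small. *)
Definition hasse_quotient (a N l : nat) : {poly K} :=
  ('X^a * g ^+ N)^`N(l) %/ g ^+ (N - l).

Let g_neq0 : g != 0. Proof. by rewrite -size_poly_gt0 sg. Qed.

Lemma hasse_quotientK a N l :
  hasse_quotient a N l * g ^+ (N - l) = ('X^a * g ^+ N)^`N(l).
Proof. by rewrite divpK // dvdp_nderivn_exp. Qed.

Lemma size_hasse_quotient a N l :
  (l <= N)%N -> (size (hasse_quotient a N l) <= (a + l * n.-1).+1)%N.
Proof.
move=> lelN; rewrite size_divp ?expf_neq0 // size_exp sg /=.
have: (size ('X^a * g ^+ N)^`N(l) <= (a + n * N).+1 - l)%N.
  apply: leq_trans (size_nderivn _ _) _; apply: leq_sub2r.
  rewrite mulrC size_mulXn ?expf_neq0 //.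
  have := size_exp g N; rewrite sg /=.
  by case: size => [|m] /= => [_|->]; lia.
have n_gt0 : (0 < n)%N.
  rewrite -ltnS -sg ltnNge; apply: contraTN gr => /size1_polyC gC.
  by rewrite gC rootC; apply: contraNneq g_neq0 => g0; rewrite gC g0.
move=> sz; rewrite leq_subLR; apply: leq_trans sz _.
case: n n_gt0 => // n' _; rewrite -pred_Sn mulnBr; nia.
Qed.

Lemma dvdp_exprDC (y : K) (t : nat) (P : {poly K}) :
  P %| (P + y%:P) ^+ t - (y ^+ t)%:P.
Proof. by rewrite rmorphXn subrXX addrK dvdp_mulr. Qed.

(** Vanishing to order [M] at [x] is reduced to polynomial identities that do not mention [x], hence
    serve all points at once. Multiplying by [g ^+ M], which is prime to ['X - x], makes every
    exponent of [g] at least [l]; modulo [('X - x) ^+ M] the factor [('X - r) ^+ Q] is the constant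
    [x - r ^+ Q]; and in the derivatives at [x] the power [g ^+ (j * B)] takes the value
    [z ^+ j]. *)
Lemma stepanov_vanishing (x : K) (I : finType) (v : I -> K) (a j t : I -> nat) :
  (M <= Q)%N -> x ^+ Q = x -> g.[x] ^+ B = z -> g.[x] != 0 ->
  (forall l, (l < M)%N ->
     \sum_i (v i * z ^+ j i) *: (hasse_quotient (a i) (j i * B + M) l *
       ('X - (r ^+ Q)%:P) ^+ t i) = 0) ->
  ('X - x%:P) ^+ M %| \sum_i v i *: ('X^(a i) * g ^+ (j i * B)
                                     * ('X - r%:P) ^+ (Q * t i)).
Proof.
move=> leMQ xQ gxB gx0 sum0; set Phi := \sum_i _.
rewrite -(@Gauss_dvdpl _ _ (g ^+ M)); last first.
  by apply/coprimep_expl/coprimep_expr; rewrite coprimep_sym coprimep_XsubC.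
pose y := x - r ^+ Q.
have XrQ : ('X - r%:P) ^+ Q = ('X - x%:P) ^+ Q + y%:P.
  rewrite -[in LHS](subrK x%:P 'X) -addrA exprDn_pchar_poly //; congr (_ + _).
  rewrite -rmorphB -rmorphXn; congr (_%:P); apply/eqP.
  by rewrite -subr_eq0 opprB addrA subr_eq0 -exprDn_pchar // subrK xQ.
pose Theta := \sum_i (v i * y ^+ t i) *: ('X^(a i) * g ^+ (j i * B + M)).
suff MTheta : ('X - x%:P) ^+ M %| Theta.
  rewrite -(subrK Theta (_ * _)) dvdp_addl // /Phi mulr_suml /Theta -sumrB.
  apply: dvdp_sum => i _; rewrite [_ ^+ (Q * _)]exprM XrQ exprD.
  rewrite -!scalerA -scalerAl -scalerBr -mul_polyC; apply: dvdp_mull.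
  have -> : 'X^(a i) * g ^+ (j i * B) * (('X - x%:P) ^+ Q + y%:P) ^+ t i * g ^+ M -
     y ^+ t i *: ('X^(a i) * (g ^+ (j i * B) * g ^+ M)) =
     'X^(a i) * g ^+ (j i * B) * g ^+ M *
       ((('X - x%:P) ^+ Q + y%:P) ^+ t i - (y ^+ t i)%:P).
    by rewrite -mul_polyC; ring.
  by apply/dvdp_mull/(dvdp_trans _ (dvdp_exprDC _ _ _))/dvdp_exp2l.
apply: dvdp_exp_XsubC_nderivn => l ltlM.
have /(congr1 (fun P : {poly K} => P.[x] * g.[x] ^+ (M - l))) := sum0 _ ltlM.
rewrite horner0 mul0r => <-; rewrite linear_sum !horner_sum mulr_suml.
apply: eq_bigr => i _; rewrite linearZ /= -hasse_quotientK !(hornerZ, hornerM).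
rewrite !horner_exp -addnBA ?(ltnW ltlM) // exprD mulnC exprM gxB.
rewrite hornerXsubC -/y; ring.
Qed.

(** The unknowns are the [k * d * B] coefficients of the [c i]; the conditions ask [M] polynomials
    of size at most [H] to vanish, and the last hypothesis says that there are fewer conditions than
    unknowns. The resulting nonzero [Phi] has a root of order [M] at each point of [S], so its
    degree bounds [size S * M]. *)
Lemma stepanov (S : seq K) :
  uniq S ->
  (forall x, x \in S -> [/\ x ^+ Q = x, g.[x] ^+ B = z & g.[x] != 0]) ->
  (M <= Q)%N -> (M * (B + k + M * n.-1) < k * d * B)%N ->
  (size S * M <= d * B * n + k.-1 * Q)%N.
Proof.
move=> uS SP leMQ ltM.
have d_gt0 : (0 < d)%N by case: d ltM => //; rewrite muln0 mul0n.
have k_gt0 : (0 < k)%N by case: k ltM => //; rewrite !mul0n.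
have n_gt0 : (0 < n)%N.
  rewrite -ltnS -sg ltnNge; apply: contraTN gr => /size1_polyC gC.
  by rewrite gC rootC; apply: contraNneq g_neq0 => g0; rewrite gC g0.
pose H := (B + k + M * n.-1)%N.
pose R (i : 'I_(k * d) * 'I_B) l : {poly K} := z ^+ (i.1 %% d) *:
  (hasse_quotient i.2 (i.1 %% d * B + M) l * ('X - (r ^+ Q)%:P) ^+ (i.1 %/ d)).
have [|v [[i0 a0] /= v0] vR] :=
  @nonzero_solution K _ _ (fun i (j : 'I_M * 'I_H) => (R i j.1)`_j.2).
  by rewrite !card_prod !card_ord.
have R0 l : (l < M)%N -> \sum_i v i *: R i l = 0.
  move=> ltl; apply/polyP => h; rewrite coef0 coef_sum.
  under eq_bigr => i _ do rewrite coefZ.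
  have [lth|leh] := ltnP h H; first exact: (vR (Ordinal ltl, Ordinal lth)).
  rewrite big1 // => i _; rewrite nth_default ?mulr0 //.
  apply: leq_trans leh; apply: leq_trans (size_scale_leq _ _) _.
  apply: leq_trans (size_polyMleq _ _) _; rewrite size_exp_XsubC addnS /=.
  have := @size_hasse_quotient i.2 (i.1 %% d * B + M) l (leq_trans (ltnW ltl) (leq_addl _ _)).
  have : (i.1 %/ d < k)%N by rewrite ltn_divLR.
  have := ltn_ord i.2.
  have : (l * n.-1 <= M * n.-1)%N by rewrite leq_mul2r (ltnW ltl) orbT.
  have aux (s q m m' a b k' : nat) : (m <= m')%N -> (a < b)%N -> (q < k')%N ->
    (s <= (a + m).+1)%N -> (s + q <= b + k' + m')%N by lia.
  exact: aux.
pose c (i : nat) : {poly K} :=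
  if insub i is Some i' then \sum_(a < B) v (i', a) *: 'X^a else 0.
have cE (i : 'I_(k * d)) : c i = \sum_(a < B) v (i, a) *: 'X^a by rewrite /c valK.
have szc i : (size (c i) <= B)%N.
  rewrite /c; case: insub => [i'|]; last by rewrite size_poly0.
  apply: (leq_trans (size_sum _ _ _)); apply/bigmax_leqP => a _.
  by apply: (leq_trans (size_scale_leq _ _)); rewrite size_polyXn.
pose Phi := \sum_(i < k * d)
  c i * g ^+ (i %% d * B) * ('X - r%:P) ^+ (Q * (i %/ d)).
have Phi0 : Phi != 0.
  apply: (@stepanov_independent c i0) => //; apply: contraNneq v0 => ci0.
  have /(congr1 (fun P : {poly K} => P`_a0)) := ci0.
  rewrite coef0 cE coef_sum (bigD1 a0) //= coefZ coefXn eqxx mulr1 big1 ?addr0.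
    by move->.
  move=> a nea; rewrite coefZ coefXn; case: eqP => [/val_inj aE|]; last by rewrite mulr0.
  by rewrite aE eqxx in nea.
have SPhi : \prod_(x <- S) ('X - x%:P) ^+ M %| Phi.
  apply: dvdp_prod_XsubC_exp => // x /SP[xQ gxB gx0].
  have -> : Phi = \sum_i v i *: ('X^(i.2) * g ^+ (i.1 %% d * B)
                                     * ('X - r%:P) ^+ (Q * (i.1 %/ d))).
    transitivity (\sum_(i < k * d) \sum_(a < B) v (i, a) *:
        ('X^a * g ^+ (i %% d * B) * ('X - r%:P) ^+ (Q * (i %/ d)))); last first.
      by rewrite pair_bigA; apply: eq_bigr => -[].
    apply: eq_bigr => i _; rewrite cE !mulr_suml.
    by apply: eq_bigr => a _; rewrite -!scalerAl.
  apply: (@stepanov_vanishing x _ v (fun i => i.2) (fun i => i.1 %% d)%N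
     (fun i => i.1 %/ d)%N) => // l ltl.
  by rewrite -[RHS](R0 _ ltl); apply: eq_bigr => i _; rewrite /R scalerA.
have szPhi : (size Phi <= d.-1 * B * n + k.-1 * Q + B)%N.
  apply: (leq_trans (size_sum _ _ _)); apply/bigmax_leqP => i _.
  apply: leq_trans (size_polyMleq _ _) _; rewrite size_exp_XsubC addnS /=.
  have := size_polyMleq (c i) (g ^+ (i %% d * B)).
  have := size_poly_exp_leq g (i %% d * B); rewrite sg /=.
  have := szc i.
  have : (Q * (i %/ d) <= k.-1 * Q)%N.
    by rewrite mulnC leq_mul2r -ltnS prednK // ltn_divLR // ltn_ord orbT.
  have : (n * (i %% d * B) <= d.-1 * B * n)%N.
    by rewrite mulnC leq_mul2r leq_mul2r -ltnS prednK // ltn_pmod // !orbT.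
  have aux (sc sh sp q m m' q' b : nat) : (m <= m')%N -> (q <= q')%N ->
    (sc <= b)%N -> (sh <= m.+1)%N -> (sp <= (sc + sh).-1)%N ->
    (sp + q <= m' + q' + b)%N by lia.
  exact: aux.
have := dvdp_leq Phi0 SPhi.
rewrite size_prod_seq; last by move=> x _; rewrite expf_neq0 // polyXsubC_eq0.
under eq_bigr => x _ do rewrite size_exp_XsubC.
rewrite big_const_seq count_predT iter_addn_0 => le1.
have dBn : (d.-1 * B * n + B <= d * B * n)%N by case: d d_gt0 => // d' _ /=; nia.
have aux (s m a b c' e : nat) : ((m.+1 * s).+1 - s <= a + b + c')%N ->
  (a + c' <= e)%N -> (s * m <= e + b)%N by rewrite mulSn (mulnC m); lia.
exact: aux (leq_trans le1 szPhi) dBn.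
Qed.

End Stepanov.

(** With Q = n + 1, the first estimate makes [M] at least about [X - 6 * R * D * X / Q - 1]. The
    left side of the last hypothesis then exceeds [Q * X] by about [19 * R * D * X - Q], the right
    side only by [2 * D * Q], and [R * X] is at least about Q. The monomials are bounded one at a
    time so that the final goal is linear in them. *)
Lemma stepanov_contradiction (n D X M R : nat) :
  (0 < D)%N -> (R < X)%N -> (1000 <= R)%N -> (R ^ 2 <= n.+1)%N ->
  (n.+1 < R.+1 ^ 2)%N -> (D <= R)%N ->
  (n * X < M.+1 * (n + 6 * (R * D)))%N ->
  ((n.+1 + 25 * R * D) * M <= n.+1 * (2 * D + X))%N -> False.
Proof.
move=> D_gt0 leRX R1000; rewrite -!mulnn => leR2 ltR2 leDR.
rewrite -mulnA; set E := (R * D)%N => ltMW leP.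
pose T := (D * n.+1)%N.
have leRn : (1000 * R <= n.+1)%N by apply: leq_trans leR2; rewrite leq_mul2r R1000 orbT.
have leDn : (E <= n.+1)%N by apply: leq_trans leR2; rewrite leq_mul2l leDR orbT.
have leET : (1000 * E <= T)%N by rewrite /E /T mulnA mulnC leq_mul2l leRn orbT.
have leTX : (999 * T <= 1000 * (E * X))%N.
  have : (R * R.+1 <= R * X)%N by rewrite leq_mul2l leRX orbT.
  move=> h; have : (999 * n.+1 <= 1000 * (R * X))%N by lia.
  move=> {}h; have := leq_mul (leqnn D) h; rewrite /E /T; lia.
have leEE : (1000 * (E * E) <= T * n.+1)%N by rewrite mulnA leq_mul.
have leEn : (1000 * (E * n.+1) <= T * n.+1)%N by rewrite mulnA leq_mul.
have leTE : (T * E <= T * n.+1)%N by rewrite leq_mul.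
have lenT : (n.+1 * n.+1 <= T * n.+1)%N by rewrite /T leq_mul2r leq_pmull ?orbT.
have leTXn : (999 * (T * n) <= 1000 * (E * X * n))%N by have := leq_mul leTX (leqnn n); lia.
have leEXn : ((n.+1 + 25 * E) * (n * X) <
   (n.+1 + 25 * E + n.+1 * (2 * D + X)) * (n + 6 * E))%N.
  have h : ((n.+1 + 25 * E) * M.+1 <= n.+1 + 25 * E + n.+1 * (2 * D + X))%N.
    by rewrite mulnS leq_add2l.
  apply: leq_trans (leq_mul h (leqnn _)); rewrite -mulnA ltn_pmul2l //.
have h1 : (25 * (E * X * n) < (n.+1 + 25 * E) * (n + 6 * E) +
   2 * T * (n + 6 * E) + 6 * (E * X * n) + 6 * (E * X))%N.
  by rewrite /T; move: leEXn; clear; lia.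
have h2 : (1000 * (E * X) <= n.+1 * (E * X))%N.
  by rewrite leq_mul2r; apply/orP; right; lia.
have h3 : (1000 * T <= T * n.+1)%N by rewrite mulnC leq_mul2l; apply/orP; right; lia.
have h4 : (T <= E * X)%N by lia.
move: h1 h2 h3 h4 leTXn leEE leEn leTE lenT; clearbody T E; clear; lia.
Qed.

(* With [k] about [R / d2] and [M] about [d2 * k], the loss in Stepanov's
   inequality is of order [R]. *)
Lemma stepanov_parameters (n d1 d2 R : nat) :
  (0 < d1)%N -> (0 < d2)%N -> (d2 %| n)%N -> (d1 * d2 <= R)%N -> (1000 <= R)%N ->
  (R ^ 2 <= n.+1)%N -> (n.+1 < R.+1 ^ 2)%N ->
  exists k M : nat, [/\ (M <= n.+1)%N,
    (M * (n %/ d2 + k + M * (2 * d1).-1) < k * d2 * (n %/ d2))%N &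
    forall N, (N * d1 * M <= d2 * (n %/ d2) * (2 * d1) + k.-1 * n.+1)%N ->
      (N * (d1 * d2) <= n.+1 + 25 * R * (d1 * d2))%N].
Proof.
move=> d1_gt0 d2_gt0 d2n leDR R1000 leR2 ltR2.
set B := (n %/ d2)%N; have Bd : (d2 * B = n)%N by rewrite mulnC divnK.
pose k := (R %/ d2).+1; pose X := (d2 * k)%N; pose D := (d1 * d2)%N.
have leRX : (R < X)%N by rewrite /X mulnC ltn_ceil.
have leXR : (X <= R + d2)%N.
  by rewrite /X /k mulnS addnC leq_add2r mulnC leq_divM.
have D_gt0 : (0 < D)%N by rewrite muln_gt0 d1_gt0.
have led2D : (d2 <= D)%N by rewrite leq_pmull.
(* Multiplied by [d2], the Stepanov condition reads [M * (n + X + M * d2 * (2 * d1 - 1)) < n * X].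
   Since [M <= X], the bracket is below [Y], so the floor of [n * X / Y] is an admissible [M]. *)
pose Y := (n + X * (1 + 2 * D))%N.
pose M := ((n * X) %/ Y)%N.
have Y_gt0 : (0 < Y)%N by rewrite /Y; lia.
have leMY : (M * Y <= n * X)%N by rewrite leq_divM.
have ltMY : (n * X < M.+1 * Y)%N by rewrite ltn_ceil.
have leDn : (R * D <= n.+1)%N by apply: leq_trans leR2; rewrite -mulnn leq_mul2l leDR orbT.
have leMX : (M <= X)%N.
  rewrite -(leq_pmul2r Y_gt0); apply: leq_trans leMY _; rewrite mulnC leq_mul2l /Y; lia.
have ltYM : (X * (1 + 2 * D) <= 6 * (R * D))%N.
  have: (X <= 2 * R)%N by rewrite /D in led2D *; lia.
  have: (1 + 2 * D <= 3 * D)%N by lia.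
  by move=> h1 h2; apply: leq_trans (leq_mul h2 h1) _; lia.
have M_gt0 : (0 < M)%N.
  rewrite divn_gt0 // /Y; have: (X * (1 + 2 * D) <= 6 * n.+1)%N by lia.
  have : (1000 * n <= n * X)%N by rewrite mulnC leq_mul2l; lia.
  lia.
exists k, M; split.
- apply: (leq_trans leMX); apply: leq_trans leXR _.
  have led2R : (d2 <= R)%N by apply: leq_trans led2D leDR.
  have : (1000 * R <= R * R)%N by rewrite leq_mul2r R1000 orbT.
  by rewrite mulnn; lia.
- rewrite -(ltn_pmul2l d2_gt0).
  have -> : (d2 * (k * d2 * B) = n * X)%N by rewrite -Bd /X; lia.
  apply: leq_trans leMY; rewrite /Y.
  have -> : (d2 * (M * (B + k + M * (2 * d1).-1)) =
     M * (n + X + M * (d2 * (2 * d1).-1)))%N by rewrite -Bd /X; lia.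
  rewrite ltn_pmul2l // mulnDr muln1 -addnA !ltn_add2l.
  apply: leq_ltn_trans (leq_mul leMX (leqnn _)) _.
  rewrite ltn_pmul2l; last by lia.
  have -> : (2 * D = d2 * (2 * d1))%N by rewrite /D; lia.
  by rewrite ltn_pmul2l //; lia.
move=> N leN; rewrite leqNgt; apply/negP => ltN.
have {}leN : (N * D * M <= n.+1 * (2 * D + X))%N.
  have : (d2 * (N * d1 * M) <= d2 * (d2 * B * (2 * d1) + k.-1 * n.+1))%N.
    by rewrite leq_mul2l leN orbT.
  have -> : (d2 * (N * d1 * M) = N * D * M)%N by rewrite /D; lia.
  move/leq_trans; apply; rewrite Bd /X /k -pred_Sn.
  have -> : (n.+1 * (2 * D + d2 * (R %/ d2).+1) =
    d2 * (n * (2 * d1) + R %/ d2 * n.+1) + (2 * D + d2 * n.+1))%N by rewrite /D; lia.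
  exact: leq_addr.
have : ((n.+1 + 25 * R * D) * M <= n.+1 * (2 * D + X))%N.
  by apply: leq_trans leN; rewrite leq_mul2r ltnW ?orbT.
have leY : (Y <= n + 6 * (R * D))%N by rewrite /Y leq_add2l.
have ltMW : (n * X < M.+1 * (n + 6 * (R * D)))%N.
  by apply: leq_trans ltMY _; rewrite leq_mul2l leY orbT.
exact: (@stepanov_contradiction n D X M R).
Qed.

(** * Values of a quadratic polynomial in cosets of powers *)

Lemma pnat_pchar_card (F : finFieldType) : [pchar F].-nat #|F|.
Proof.
have [p p_pr pF] := finPcharP F.
have : p.-nat #|F| by have := pprimeChar_pgroup pF; rewrite /pgroup cardsT.
by apply: sub_in_pnat => r _ /eqP ->; exact: pF.
Qed.

(** Simplicity in every characteristic, 2 included, comes from the identity b^2 - 4ac = f'(r)^2 - 4a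
    f(r). The root must be nonzero because it is pulled back along a power map, which ramifies at
    0. *)
Lemma quadratic_simple_root (K : closedFieldType) (a b c : K) :
  a != 0 -> b ^+ 2 != 4%:R * a * c ->
  exists r, [/\ r != 0, a * r ^+ 2 + b * r + c = 0 & 2%:R * a * r + b != 0].
Proof.
move=> a0 disc.
have [r r0 fr] : exists2 r, r != 0 & a * r ^+ 2 + b * r + c = 0.
  have [c0|c0] := eqVneq c 0.
    have b0 : b != 0 by move: disc; rewrite c0 mulr0 sqrf_eq0.
    by exists (- b / a); [rewrite mulf_neq0 ?invr_eq0 ?oppr_eq0 | rewrite c0; field].
  have /closed_rootP[r /rootP] : size (a *: 'X^2 + b *: 'X + c%:P) != 1%N.
    rewrite -addrA size_polyDl ?size_scale ?size_polyXn //.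
    apply: leq_ltn_trans (size_polyD _ _) _; rewrite gtn_max.
    rewrite (leq_ltn_trans (size_scale_leq _ _)) ?size_polyX //.
    by rewrite (leq_ltn_trans (size_polyC_leq1 _)).
  rewrite !(hornerD, hornerN, hornerZ, hornerC, hornerXn, hornerX) => fr; exists r => //.
  by apply: contraNneq c0 => r0; move: fr; rewrite r0 expr0n !mulr0 !add0r => ->.
exists r; split=> //; apply: contraNneq disc => dr; rewrite -subr_eq0.
have -> : b ^+ 2 - 4%:R * a * c =
  (2%:R * a * r + b) ^+ 2 - 4%:R * a * (a * r ^+ 2 + b * r + c) by ring.
by rewrite dr fr expr0n mulr0 subr0.
Qed.

(** Chain rule at [u] with [s * u ^+ d = r]: both f'(r) and [s * d * u ^+ d.-1] are nonzero. *)
Lemma quadratic_comp_simple_root (K : closedFieldType) (a b c s : K) (d : nat) :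
  a != 0 -> b ^+ 2 != 4%:R * a * c -> s != 0 -> d%:R != 0 :> K ->
  let g := (a *: 'X^2 + b *: 'X + c%:P) \Po (s *: 'X^d) in
  size g = (2 * d).+1 /\ exists2 u, root g u & ~~ root g^`() u.
Proof.
move=> a0 disc s0 d0 g.
have d_gt0 : (0 < d)%N by rewrite lt0n; apply: contraNneq d0 => ->.
have szf : size (a *: 'X^2 + b *: 'X + c%:P) = 3%N.
  rewrite -addrA size_polyDl ?size_scale ?size_polyXn //.
  apply: leq_ltn_trans (size_polyD _ _) _; rewrite gtn_max.
  rewrite (leq_ltn_trans (size_scale_leq _ _)) ?size_polyX //.
  by rewrite (leq_ltn_trans (size_polyC_leq1 _)).
have szg : size g = (2 * d).+1.
  have := size_comp_poly (a *: 'X^2 + b *: 'X + c%:P) (s *: 'X^d).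
  rewrite -/g szf size_scale // size_polyXn /=.
  by case: (size g) => [|m] /= => [|->] //; lia.
split=> //.
have [r [r0 fr dfr]] := quadratic_simple_root a0 disc.
have /closed_rootP[u /rootP] : size ('X^d - (r / s)%:P) != 1%N.
  by rewrite size_XnsubC // eqSS -lt0n.
rewrite !(hornerD, hornerN, hornerC, hornerXn) => /eqP.
rewrite subr_eq0 => /eqP ud.
have su : s * u ^+ d = r by rewrite ud mulrC divfK.
have u0 : u != 0.
  by apply: contraNneq r0 => u0; rewrite -su u0 expr0n eqn0Ngt d_gt0 mulr0.
exists u; first by rewrite /root /g horner_comp hornerZ hornerXn su
  !(hornerD, hornerZ, hornerC, hornerXn, hornerX) fr.
rewrite /root /g deriv_comp hornerM horner_comp hornerZ hornerXn su.
rewrite !(derivD, derivZ, derivXn, derivX, derivC) addr0.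
rewrite !(hornerD, hornerZ, hornerMn, hornerC, hornerXn, hornerX).
rewrite mulf_neq0 //.
  by apply: contraNneq dfr => <-; apply/eqP; ring.
by rewrite mulf_neq0 // -mulr_natl mulf_neq0 // expf_neq0.
Qed.

Section Logarithm.
Variables (F : finFieldType) (e : F).
Hypothesis eP : #|F|.-1.-primitive_root e.

(* [discrete_log 0] is a junk value. *)
Definition discrete_log (x : F) : nat :=
  if [pick i : 'I_#|F|.-1 | e ^+ i == x] is Some i then i else 0%N.
Local Notation lg := discrete_log.

Lemma ltn_discrete_log x : (lg x < #|F|.-1)%N.
Proof. by rewrite /lg; case: pickP => [i _|_] //; exact: prim_order_gt0 eP. Qed.

Lemma expf_pred_card (x : F) : x != 0 -> x ^+ #|F|.-1 = 1.
Proof.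
move=> x0; apply: (mulfI x0); rewrite -exprS prednK ?expf_card ?mulr1 //.
exact: ltnW (finNzRing_gt1 _).
Qed.

Lemma discrete_logK x : x != 0 -> e ^+ lg x = x.
Proof.
move=> /expf_pred_card x1; rewrite /lg; case: pickP => [i /eqP //|nolog].
by have [i xE] := prim_rootP eP x1; have := nolog i; rewrite -xE eqxx.
Qed.

Lemma prim_root_neq0 i : e ^+ i != 0.
Proof.
apply/expf_neq0/eqP => e0; have := prim_expr_order eP; rewrite e0.
by rewrite expr0n eqn0Ngt (prim_order_gt0 eP) => /eqP; rewrite eq_sym oner_eq0.
Qed.

(** A residue class of the logarithm becomes the equation g^B = z of Stepanov's method. *)
Lemma expf_discrete_log (d : nat) x : (d %| #|F|.-1)%N -> x != 0 ->
  x ^+ (#|F|.-1 %/ d) = e ^+ (lg x %% d * (#|F|.-1 %/ d)).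
Proof.
move=> dn x0; rewrite -{1}(discrete_logK x0) -exprM {1}(divn_eq (lg x) d).
rewrite mulnDl exprD -mulnA (mulnC d) divnK // mulnC exprM.
by rewrite (prim_expr_order eP) expr1n mul1r.
Qed.

Definition log_class (f : {poly F}) (d1 d2 a1 a2 : nat) : {set F} :=
  [set x | [&& x != 0, f.[x] != 0, (lg x %% d1)%N == a1 & (lg f.[x] %% d2)%N == a2]].

(** Each [x] in the class equals [s * v ^+ d1] for [d1] values of [v], so bounding the set of all
    such [v] gains the factor [d1]. Stepanov's method runs over the algebraic closure because the
    simple root of [g] need not lie in [F]. *)
Lemma log_class_bound (a b c : F) (d1 d2 a1 a2 R : nat) :
  let f := a *: 'X^2 + b *: 'X + c%:P in
  a != 0 -> b ^+ 2 != 4%:R * a * c ->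
  (d1 %| #|F|.-1)%N -> (d2 %| #|F|.-1)%N -> (d1 * d2 <= R)%N ->
  (1000 <= R)%N -> (R ^ 2 <= #|F|)%N -> (#|F| < R.+1 ^ 2)%N ->
  (#|log_class f d1 d2 a1 a2| * (d1 * d2) <= #|F| + 25 * R * (d1 * d2))%N.
Proof.
move=> f a0 disc d1n d2n leR R1000 leR2 ltR2.
have n_gt0 := prim_order_gt0 eP; set n := #|F|.-1 in n_gt0 d1n d2n *.
have nE : #|F| = n.+1 by rewrite prednK // ltnW // finNzRing_gt1.
have d1_gt0 : (0 < d1)%N := dvdn_gt0 n_gt0 d1n.
have d2_gt0 : (0 < d2)%N := dvdn_gt0 n_gt0 d2n.
rewrite nE in leR2 ltR2 *.
have [k [M [leM ltM ->]]//] := stepanov_parameters d1_gt0 d2_gt0 d2n leR R1000 leR2 ltR2.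
have [K [iota _]] := countable_algebraic_closure F.
pose s := e ^+ a1.
pose g := map_poly iota (f \Po (s *: 'X^d1)).
have gE : g = (iota a *: 'X^2 + iota b *: 'X + (iota c)%:P) \Po (iota s *: 'X^d1).
  rewrite /g map_comp_poly /f !rmorphD /= !map_polyZ /= !map_polyXn map_polyX.
  by rewrite map_polyC.
(* [d1] divides Q - 1 and Q is 0 in [F], so [d1] is invertible. *)
have d1K : d1%:R != 0 :> K.
  have nF : n.+1%:R = 0 :> F.
    by rewrite -nE -FinRing.zmodXgE -cardsT expg_cardG ?inE.
  rewrite -(rmorph_nat iota) fmorph_eq0; apply/eqP => d10; move: nF.
  by rewrite -(divnK d1n) -natr1 natrM d10 mulr0 add0r => /eqP; rewrite oner_eq0.
have [] := @quadratic_comp_simple_root K (iota a) (iota b) (iota c) (iota s) d1.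
- by rewrite fmorph_eq0.
- by rewrite -rmorphXn -(rmorph_nat iota) -!rmorphM (inj_eq (fmorph_inj iota)).
- by rewrite fmorph_eq0 prim_root_neq0.
- exact: d1K.
rewrite -gE => szg [u gu g'u].
pose S := [set v | [&& v != 0, f.[s * v ^+ d1] != 0 & (lg f.[s * v ^+ d1] %% d2)%N == a2]].
have cardS : (#|log_class f d1 d2 a1 a2| * d1 <= #|S|)%N.
  (* The [d1] solutions [v] belonging to [x]: their logarithms differ by multiples of [n / d1]. *)
  pose phi (y : F * 'I_d1) := e ^+ (lg y.1 %/ d1 + y.2 * (n %/ d1)).
  rewrite -[X in (_ * X)%N]card_ord -cardsT -cardsX -(card_in_imset (f := phi)).
    apply/subset_leq_card/subsetP => y /imsetP[[x i]]; rewrite !inE andbT /=.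
    case/and4P=> x0 fx0 /eqP x1 /eqP x2 ->.
    have -> : s * phi (x, i) ^+ d1 = x.
      rewrite /phi /s -exprM -exprD /=.
      have -> : (a1 + (lg x %/ d1 + i * (n %/ d1)) * d1 = lg x + n * i)%N.
        have xE := divn_eq (lg x) d1; rewrite x1 in xE.
        by rewrite mulnDl -mulnA (divnK d1n) (mulnC i) addnA (addnC a1) -xE.
      by rewrite exprD exprM (prim_expr_order eP) expr1n mulr1 discrete_logK.
    by rewrite prim_root_neq0 fx0 x2 eqxx.
  have n1_gt0 : (0 < n %/ d1)%N by rewrite divn_gt0 // dvdn_leq.
  have phi_lt x (i : 'I_d1) : (lg x %/ d1 + i * (n %/ d1) < n)%N.
    rewrite -[X in (_ < X)%N](divnK d1n) (mulnC _ d1).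
    have: (i.+1 * (n %/ d1) <= d1 * (n %/ d1))%N by rewrite leq_mul2r ltn_ord orbT.
    move=> h; apply: leq_trans _ h; rewrite mulSn ltn_add2r ltn_divLR // divnK //.
    exact: ltn_discrete_log.
  have lg_lt x : (lg x %/ d1 < n %/ d1)%N by rewrite ltn_divLR // divnK // ltn_discrete_log.
  move=> [x i] [y j]; rewrite !inE !andbT /= => /and4P[x0 _ /eqP x1 _] /and4P[y0 _ /eqP y1 _].
  rewrite /phi /= => /eqP; rewrite (eq_prim_root_expr eP) !modn_small ?phi_lt // => /eqP E.
  have Eq := congr1 (modn^~ (n %/ d1)%N) E; have Ei := congr1 (divn^~ (n %/ d1)%N) E.
  move: Eq Ei; rewrite /= ![(_ %/ _ + _)%N]addnC !modnMDl !divnMDl // !(modn_small (lg_lt _)).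
  rewrite !(divn_small (lg_lt _)) !addn0 => Eq Ei; congr (_, _); last exact: val_inj.
  by rewrite -(discrete_logK x0) -(discrete_logK y0) (divn_eq (lg x) d1) Eq x1 -y1 -divn_eq.
pose z := iota (e ^+ (a2 * (n %/ d2))).
have KQ : [pchar K].-nat n.+1.
  by rewrite -nE (eq_pnat _ (fmorph_pchar iota)) pnat_pchar_card.
apply: (leq_trans (leq_mul cardS (leqnn M))).
have -> : #|S| = size [seq iota v | v <- enum S] by rewrite size_map -cardE.
apply: (@stepanov K n.+1 (n %/ d2) d2 k M (2 * d1) g u z) => //.
- by rewrite mulnC divnK.
- by rewrite (map_inj_uniq (fmorph_inj iota)) enum_uniq.
move=> w /mapP[v]; rewrite mem_enum inE => /and3P[v0 fv0 /eqP lgv] ->.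
rewrite /g horner_map horner_comp hornerZ hornerXn fmorph_eq0 fv0.
by rewrite -!rmorphXn -nE expf_card -/n expf_discrete_log // lgv.
Qed.

End Logarithm.

(** * The sieve *)

(* [e] is the product of the primes treated exactly, [L] lists those removed by
   the union bound, and [25 * R] is the error for one residue class.  A prime
   [l] with [e * e * l > R] is removed trivially, at a cost below
   [4 * e ^+ 2 * R]. *)
Definition sieve_bound (n R e : nat) (L : seq nat) : rat :=
  (totient e)%:R ^+ 2 * n.+1%:R / e%:R ^+ 2 * (1 - 2 * \sum_(l <- L) l%:R^-1)
    - (25 * e%:R ^+ 2 +
       (size L)%:R * (50 * (totient e)%:R ^+ 2 + 4 * e%:R ^+ 2)) * R%:R - 3.

Definition sieve_admissible (n R e : nat) (L : seq nat) : Prop :=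
  [/\ (e %| n)%N, (e * e <= R)%N, all (fun l => (l %| n)%N && coprime e l) L &
      forall p, prime p -> (p %| n)%N -> (p %| e)%N || (p \in L)].

Definition sieve_exists (n R q : nat) : Prop :=
  exists e L, sieve_admissible n R e L /\ 12 * n.+1%:R / q%:R < sieve_bound n R e L.

Section Sieve.
Variables (T : finType) (u v : T -> nat).
Implicit Types (X : {set T}) (e l : nat).

Lemma card_residue_classes X e (P : nat -> nat -> bool) (B : rat) : (0 < e)%N ->
  (forall a b, #|[set x in X | (u x %% e == a)%N && (v x %% e == b)%N]|%:R <= B) ->
  #|[set x in X | P (u x %% e)%N (v x %% e)%N]|%:R <=
  #|[set ab : 'I_e * 'I_e | P ab.1 ab.2]|%:R * B.
Proof.
move=> e_gt0 leB.
pose res x := (Ordinal (ltn_pmod (u x) e_gt0), Ordinal (ltn_pmod (v x) e_gt0)).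
rewrite -[X in X%:R <= _]sum1_card.
rewrite (partition_big res [in [set ab : 'I_e * 'I_e | P ab.1 ab.2]]) /=; last first.
  by move=> x; rewrite !inE => /andP[].
rewrite -[X in _ <= X%:R * _]sum1_card natr_sum [X in _ <= X * _]natr_sum mulr_suml.
apply: ler_sum => -[a b] _; rewrite mul1r.
apply: le_trans (leB a b); rewrite ler_nat sum1_card.
apply/subset_leq_card/subsetP => x; rewrite unfold_in !inE => /andP[/andP[-> _] /eqP[<- <-]].
by rewrite !eqxx.
Qed.

Lemma card_coprime_residues e :
  #|[set ab : 'I_e * 'I_e | coprime e ab.1 && coprime e ab.2]| = (totient e ^ 2)%N.
Proof.
have phiE : totient e = #|[set a : 'I_e | coprime e a]|.
  rewrite totient_count_coprime big_mkord -sum1_card [RHS]big_mkcond /=.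
  by apply: eq_bigr => a _; rewrite inE; case: coprime.
rewrite phiE -mulnn -cardsX; apply: eq_card => -[a b].
by rewrite !inE.
Qed.

Variables (X : {set T}) (n R : nat).
Hypothesis leXn : (n <= #|X| + 2)%N.
Hypothesis class_bound : forall d1 d2 a1 a2, (d1 %| n)%N -> (d2 %| n)%N ->
  (d1 * d2 <= R)%N ->
  (#|[set x in X | (u x %% d1 == a1)%N && (v x %% d2 == a2)%N]| * (d1 * d2)
    <= n.+1 + 25 * R * (d1 * d2))%N.
Hypothesis u_bound : forall l, (l %| n)%N ->
  (#|[set x in X | (l %| u x)%N]| * l <= n)%N.
Hypothesis v_bound : forall l, (l %| n)%N ->
  (#|[set x in X | (l %| v x)%N]| * l <= 2 * n)%N.
Hypotheses (n_gt0 : (0 < n)%N) (R1000 : (1000 <= R)%N) (ltRn : (n.+1 < R.+1 ^ 2)%N).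

Let classB d1 d2 : rat := n.+1%:R / (d1 * d2)%:R + 25 * R%:R.

Let classB_ge0 d1 d2 : 0 <= classB d1 d2.
Proof. by rewrite addr_ge0 ?mulr_ge0 ?invr_ge0 ?ler0n. Qed.

Lemma class_boundr d1 d2 a1 a2 : (d1 %| n)%N -> (d2 %| n)%N -> (d1 * d2 <= R)%N ->
  #|[set x in X | (u x %% d1 == a1)%N && (v x %% d2 == a2)%N]|%:R <= classB d1 d2.
Proof.
move=> d1n d2n leR; have D_gt0 : (0 < d1 * d2)%N.
  by rewrite muln_gt0 !(dvdn_gt0 n_gt0).
rewrite /classB -(ler_pM2r (x := (d1 * d2)%:R)) ?ltr0n //.
rewrite mulrDl divfK ?pnatr_eq0 -?lt0n // -!natrM -natrD ler_nat.
exact: class_bound.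
Qed.

Definition coprime_part e :=
  [set x in X | coprime e (u x %% e) && coprime e (v x %% e)].

(** Subtract the [e ^ 2 - totient e ^ 2] bad residue pairs, each bounded above, from a total of at
    least Q - 3. *)
Lemma coprime_part_lower e : (e %| n)%N -> (e * e <= R)%N ->
  (totient e)%:R ^+ 2 * n.+1%:R / e%:R ^+ 2 - 25 * R%:R * e%:R ^+ 2 - 3
    <= #|coprime_part e|%:R :> rat.
Proof.
move=> en leR; have e_gt0 := dvdn_gt0 n_gt0 en.
pose P a b := ~~ (coprime e a && coprime e b).
have := @card_residue_classes X e P (classB e e) e_gt0.
move=> /(_ (fun a b => class_boundr a b en en leR)).
have -> : [set x in X | P (u x %% e)%N (v x %% e)%N] = X :\: coprime_part e.
  by apply/setP => x; rewrite !inE /P; case: (x \in X); rewrite ?andbF ?andbT.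
have -> : [set ab : 'I_e * 'I_e | P ab.1 ab.2] =
    ~: [set ab : 'I_e * 'I_e | coprime e ab.1 && coprime e ab.2].
  by apply/setP => ab; rewrite !inE.
rewrite cardsD (setIidPr _); last by apply/subsetP => x; rewrite inE => /andP[].
have cardE := cardsC [set ab : 'I_e * 'I_e | coprime e ab.1 && coprime e ab.2].
rewrite card_coprime_residues card_prod card_ord in cardE.
have cC : #|~: [set ab : 'I_e * 'I_e | coprime e ab.1 && coprime e ab.2]|%:R =
   e%:R ^+ 2 - (totient e)%:R ^+ 2 :> rat.
  by rewrite -!natrX -[(e ^ 2)%N]mulnn -cardE natrD addrAC subrr add0r.
rewrite cC natrB; last by apply/subset_leq_card/subsetP => x; rewrite inE => /andP[].
rewrite /classB natrM -expr2.
have : (n%:R <= #|X|%:R + 2 :> rat) by rewrite -natrD ler_nat.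
rewrite -[n.+1]addn1 natrD.
have e0 : e%:R != 0 :> rat by rewrite pnatr_eq0 -lt0n.
have R0 : 0 <= R%:R :> rat by rewrite ler0n.
have -> : (e%:R ^+ 2 - (totient e)%:R ^+ 2) * ((n%:R + 1) / e%:R ^+ 2 + 25 * R%:R) =
  n%:R + 1 - (totient e)%:R ^+ 2 * (n%:R + 1) / e%:R ^+ 2 +
  25 * R%:R * e%:R ^+ 2 - 25 * R%:R * (totient e)%:R ^+ 2 :> rat by field.
have : 0 <= R%:R * (totient e)%:R ^+ 2 :> rat by rewrite mulr_ge0 // exprn_ge0.
lra.
Qed.

Lemma card_coprime_part e (Y : {set T}) (B : rat) : (0 < e)%N ->
  (forall a b, #|[set x in Y | (u x %% e == a)%N && (v x %% e == b)%N]|%:R <= B) ->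
  #|[set x in Y | coprime e (u x %% e) && coprime e (v x %% e)]|%:R <=
    (totient e)%:R ^+ 2 * B.
Proof.
move=> e_gt0 leB.
have := @card_residue_classes Y e (fun a b => coprime e a && coprime e b) B e_gt0 leB.
by rewrite card_coprime_residues natrX.
Qed.

Lemma eq_mod_coprime_mul e l (i j : nat) : coprime e l ->
  (i %% e = j %% e)%N -> (l %| i)%N -> (l %| j)%N -> (i %% (e * l) == j %% (e * l))%N.
Proof.
by move=> co ij li lj; rewrite chinese_remainder // ij eqxx (eqP li) (eqP lj) eqxx.
Qed.

(** If [e * l * e <= R], the class bound with moduli [e * l] and [e], in either order, gives both
    terms. Otherwise the condition modulo [e] is dropped: at most [n / l] and [2 * n / l] elements
    remain, and [l > R / e ^ 2] with [n <= (R + 2) * R] bounds their sum by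
    [3 * e ^ 2 * (R + 2) <= 4 * e ^ 2 * R]. *)
Lemma coprime_part_dvd_le e l : (e %| n)%N -> (l %| n)%N -> coprime e l ->
  #|[set x in coprime_part e | (l %| u x)%N]|%:R +
  #|[set x in coprime_part e | (l %| v x)%N]|%:R <=
    2 * ((totient e)%:R ^+ 2 * n.+1%:R / e%:R ^+ 2) * l%:R^-1 +
    (50 * (totient e)%:R ^+ 2 + 4 * e%:R ^+ 2) * R%:R :> rat.
Proof.
move=> en ln co; have e_gt0 := dvdn_gt0 n_gt0 en; have l_gt0 := dvdn_gt0 n_gt0 ln.
have e0 : e%:R != 0 :> rat by rewrite pnatr_eq0 -lt0n.
have l0 : l%:R != 0 :> rat by rewrite pnatr_eq0 -lt0n.
have R_gt0 : 0 < R%:R :> rat by rewrite ltr0n; lia.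
have eln : (e * l %| n)%N by rewrite Gauss_dvd // en.
have [leR|ltR] := leqP (e * l * e) R.
  have leu : #|[set x in coprime_part e | (l %| u x)%N]|%:R <=
      (totient e)%:R ^+ 2 * classB (e * l) e.
    have -> : [set x in coprime_part e | (l %| u x)%N] =
        [set x in [set y in X | (l %| u y)%N] |
          coprime e (u x %% e) && coprime e (v x %% e)].
      by apply/setP => x; rewrite !inE andbAC.
    apply: card_coprime_part => // a b.
    (* By the Chinese remainder theorem all of [Y] lies in a single class modulo [e * l]; any member
       [x0] names it. *)
    set Y := [set x in _ | _]; have [->|[x0]] := set_0Vmem Y.
      by rewrite cards0 classB_ge0.
    rewrite !inE => /andP[/andP[_ lx0] /andP[/eqP ux0 _]].
    apply: le_trans (class_boundr (u x0 %% (e * l))%N b eln en leR).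
    rewrite ler_nat; apply/subset_leq_card/subsetP => x; rewrite !inE.
    move=> /andP[/andP[-> lx] /andP[/eqP ux ->]]; rewrite andbT /=.
    by apply: eq_mod_coprime_mul => //; rewrite ux.
  have lev : #|[set x in coprime_part e | (l %| v x)%N]|%:R <=
      (totient e)%:R ^+ 2 * classB e (e * l).
    have -> : [set x in coprime_part e | (l %| v x)%N] =
        [set x in [set y in X | (l %| v y)%N] |
          coprime e (u x %% e) && coprime e (v x %% e)].
      by apply/setP => x; rewrite !inE andbAC.
    apply: card_coprime_part => // a b.
    set Y := [set x in _ | _]; have [->|[x0]] := set_0Vmem Y.
      by rewrite cards0 classB_ge0.
    rewrite !inE => /andP[/andP[_ lx0] /andP[_ /eqP vx0]].
    rewrite mulnC in leR.
    apply: le_trans (class_boundr a (v x0 %% (e * l))%N en eln leR).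
    rewrite ler_nat; apply/subset_leq_card/subsetP => x; rewrite !inE.
    move=> /andP[/andP[-> lx] /andP[-> /eqP vx]] /=.
    by apply: eq_mod_coprime_mul => //; rewrite vx.
  apply: le_trans (lerD leu lev) _; rewrite /classB !natrM.
  have -> : (totient e)%:R ^+ 2 * (n.+1%:R / (e%:R * l%:R * e%:R) + 25 * R%:R) +
    (totient e)%:R ^+ 2 * (n.+1%:R / (e%:R * (e%:R * l%:R)) + 25 * R%:R) =
    2 * ((totient e)%:R ^+ 2 * n.+1%:R / e%:R ^+ 2) * l%:R^-1 +
    50 * (totient e)%:R ^+ 2 * R%:R :> rat by field; rewrite e0 l0.
  have : 0 <= e%:R ^+ 2 * R%:R :> rat by rewrite mulr_ge0 ?exprn_ge0 ?ler0n.
  lra.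
have trivial_le (N c : nat) : (N * l <= c * n)%N -> (N <= c * ((R + 2) * (e * e)))%N.
  move=> leN; rewrite -(leq_pmul2r (m := R)) -?(ltr0n rat) //.
  have leNR : (N * R <= N * l * (e * e))%N.
    by rewrite -mulnA leq_mul2l; apply/orP; right; lia.
  apply: leq_trans leNR _; apply: leq_trans (leq_mul leN (leqnn _)) _.
  have lenR : (n <= (R + 2) * R)%N by move: ltRn; rewrite -mulnn; lia.
  have := leq_mul (leqnn (c * (e * e))) lenR; lia.
have leu : (#|[set x in coprime_part e | (l %| u x)%N]| <= 1 * ((R + 2) * (e * e)))%N.
  apply: trivial_le; rewrite mul1n; apply: leq_trans (u_bound ln).
  rewrite leq_mul2r; apply/orP; right; apply/subset_leq_card/subsetP => x.
  by rewrite !inE => /andP[/andP[-> _] ->].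
have lev : (#|[set x in coprime_part e | (l %| v x)%N]| <= 2 * ((R + 2) * (e * e)))%N.
  apply: trivial_le; apply: leq_trans (v_bound ln).
  rewrite leq_mul2r; apply/orP; right; apply/subset_leq_card/subsetP => x.
  by rewrite !inE => /andP[/andP[-> _] ->].
have le4 : (3 * ((R + 2) * (e * e)) <= 4 * (e * e) * R)%N.
  have := leq_mul R1000 (leqnn (e * e)); lia.
rewrite -natrD.
apply: (@le_trans _ _ (4 * (e * e) * R)%:R); first by rewrite ler_nat; lia.
have : 0 <= 2 * ((totient e)%:R ^+ 2 * n.+1%:R / e%:R ^+ 2) * l%:R^-1 :> rat.
  by rewrite !mulr_ge0 ?invr_ge0 ?exprn_ge0 ?ler0n.
have : 0 <= (totient e)%:R ^+ 2 * R%:R :> rat by rewrite mulr_ge0 ?exprn_ge0 ?ler0n.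
by rewrite !natrM -expr2; lra.
Qed.

Lemma sieve_lower e (L : seq nat) : (e %| n)%N -> (e * e <= R)%N ->
  all (fun l => (l %| n)%N && coprime e l) L ->
  sieve_bound n R e L
  <= #|[set x in coprime_part e |
         all (fun l => ~~ (l %| u x)%N && ~~ (l %| v x)%N) L]|%:R.
Proof.
rewrite /sieve_bound => en leR; elim: L => [_|l L IHL /= /andP[/andP[ln co] /IHL]] /=.
  rewrite big_nil mulr0 subr0 mulr1 mul0r addr0.
  have -> : [set x in coprime_part e | true] = coprime_part e.
    by apply/setP => x; rewrite !inE andbT.
  by apply: le_trans (coprime_part_lower en leR); lra.
set G := [set x in _ | all _ L]; set G' := [set x in _ | _ && _] => leG.
have leGG' : #|G|%:R <= #|G'|%:R + (#|[set x in coprime_part e | (l %| u x)%N]|%:R +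
    #|[set x in coprime_part e | (l %| v x)%N]|%:R) :> rat.
  rewrite -!natrD ler_nat.
  apply: leq_trans _ (leq_add (leqnn #|G'|) (leq_card_setU _ _)).
  apply: leq_trans _ (leq_card_setU _ _); apply/subset_leq_card/subsetP => x.
  rewrite !inE => /andP[-> ->]; rewrite andbT /=.
  by case: (l %| u x)%N; case: (l %| v x)%N.
have := coprime_part_dvd_le en ln co.
have aux (A z li s r w cc h g g' : rat) :
    A * (1 - 2 * s) - (25 * z + w * cc) * r - 3 <= g -> g <= g' + h ->
    h <= 2 * A * li + cc * r ->
    A * (1 - 2 * (li + s)) - (25 * z + (w + 1) * cc) * r - 3 <= g' by nra.
by rewrite big_cons -[(size L).+1%:R]natr1; apply: aux leG leGG'.
Qed.

Lemma coprime_sieve e (L : seq nat) : sieve_admissible n R e L ->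
  sieve_bound n R e L <= #|[set x in X | coprime n (u x) && coprime n (v x)]|%:R.
Proof.
move=> [en leR Ln primesL]; apply: le_trans (sieve_lower en leR Ln) _.
rewrite ler_nat; apply/subset_leq_card/subsetP => x; rewrite !inE.
move=> /andP[/and3P[-> cou cov] /allP Lx] /=.
have co w : coprime e (w %% e) -> (forall l, l \in L -> ~~ (l %| w)%N) -> coprime n w.
  rewrite coprime_modr => ew Lw; rewrite /coprime eqn_leq gcdn_gt0 n_gt0 andbT.
  rewrite leqNgt; apply/negP => /pdivP[p p_pr]; rewrite dvdn_gcd => /andP[pn pw].
  case/orP: (primesL p p_pr pn) => [pe|/Lw]; last by rewrite pw.
  have : (p %| gcdn e w)%N by rewrite dvdn_gcd pe.
  by rewrite (eqP ew) dvdn1 => /eqP p1; rewrite p1 in p_pr.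
by rewrite !co // => l /Lx /andP[].
Qed.

End Sieve.

(** * Choosing the sieved primes *)

Section PrimeProducts.
Implicit Types (s L : seq nat).

Lemma coprime_prod_primes s p : prime p -> all prime s -> p \notin s ->
  coprime (\prod_(r <- s) r)%N p.
Proof.
move=> p_pr; elim: s => [|r s IHs] /=; first by rewrite big_nil coprime1n.
move=> /andP[r_pr s_pr]; rewrite inE negb_or big_cons coprimeMl => /andP[pr ps].
by rewrite IHs // andbT prime_coprime // dvdn_prime2 // eq_sym.
Qed.

Lemma dvdn_prod_primes s n : uniq s -> all prime s -> all (fun p => p %| n)%N s ->
  (\prod_(p <- s) p %| n)%N.
Proof.
elim: s => [|p s IHs] /=; first by rewrite big_nil dvd1n.
move=> /andP[ps us] /andP[p_pr s_pr] /andP[pn sn]; rewrite big_cons.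
by rewrite Gauss_dvd ?pn ?IHs // coprime_sym coprime_prod_primes.
Qed.

Lemma totient_prod_primes s : uniq s -> all prime s ->
  totient (\prod_(p <- s) p)%N = (\prod_(p <- s) p.-1)%N.
Proof.
elim: s => [|p s IHs] /=; first by rewrite !big_nil.
move=> /andP[ps us] /andP[p_pr s_pr]; rewrite !big_cons.
by rewrite totient_coprime ?IHs ?totient_prime // coprime_sym coprime_prod_primes.
Qed.

Lemma prod_primesE s : (\prod_(p <- s) p)%N%:R = \prod_(p <- s) p%:R :> rat.
Proof. by rewrite natr_prod. Qed.

Lemma prod_predE s : all prime s ->
  (\prod_(p <- s) p.-1)%N%:R = \prod_(p <- s) (p%:R - 1) :> rat.
Proof.
move=> /allP s_pr; rewrite natr_prod big_seq [RHS]big_seq.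
by apply: eq_bigr => p /s_pr /prime_gt0 p_gt0; rewrite -subn1 natrB.
Qed.

Lemma sieve_admissible_prod n R s L : (0 < n)%N -> uniq (s ++ L) ->
  s ++ L =i primes n -> ((\prod_(p <- s) p) * (\prod_(p <- s) p) <= R)%N ->
  sieve_admissible n R (\prod_(p <- s) p)%N L.
Proof.
move=> n_gt0 usL sLn leR.
have primesP p : p \in s ++ L -> prime p /\ (p %| n)%N.
  by rewrite sLn mem_primes => /and3P[].
have sP : all prime s.
  by apply/allP => p ps; have [] := primesP p; rewrite ?mem_cat ?ps.
move: (usL); rewrite cat_uniq => /and3P[us /hasPn sL uL]; split=> //.
- apply: dvdn_prod_primes => //; apply/allP => p ps.
  by have [] := primesP p; rewrite ?mem_cat ?ps.
- apply/allP => l lL; have [|l_pr ->] := primesP l; first by rewrite mem_cat lL orbT.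
  by rewrite coprime_prod_primes //; apply: sL.
move=> p p_pr pn; have : p \in s ++ L by rewrite sLn mem_primes p_pr n_gt0.
rewrite mem_cat => /orP[ps|->]; last by rewrite orbT.
by rewrite (big_rem p) //= dvdn_mulr.
Qed.

Lemma ler_prod_subseq (s s0 : seq nat) (F : nat -> rat) : uniq s -> uniq s0 ->
  {subset s <= s0} -> (forall p, p \in s0 -> 1 <= F p) ->
  \prod_(p <- s) F p <= \prod_(p <- s0) F p.
Proof.
move=> us us0 ss0 F1.
rewrite (perm_big [seq p <- s0 | p \in s]) /=; last first.
  apply: uniq_perm => //; first exact: filter_uniq.
  by move=> p; rewrite mem_filter; case: (boolP (p \in s)) => // /ss0 ->.
rewrite big_filter big_mkcond big_seq [X in _ <= X]big_seq.
apply: ler_prod => p /F1 leF; case: ifP => _; rewrite ?lexx ?ler01 ?leF ?andbT //.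
exact: le_trans leF.
Qed.

(** The inverted factors are at least 1, so [ler_prod_subseq] can compare totient ratios. *)
Lemma prod_one_sub_inv s :
  \prod_(p <- s) (p%:R - 1) / \prod_(p <- s) p%:R =
  (\prod_(p <- s) (p%:R / (p%:R - 1)))^-1 :> rat.
Proof.
by rewrite big_split /= prodfV invf_div.
Qed.

End PrimeProducts.

Definition primes_upto (y : nat) : seq nat := [seq p <- iota 0 y.+1 | prime p].

Definition primes_between (y z : nat) : seq nat :=
  [seq p <- iota y.+1 (z - y) | prime p].

(* [B] plays the role of all candidates up to [z], hence of the smallest
   elements that [A] could have. *)
Section Smallest.
Variables (A B : seq nat) (z : nat).
Hypotheses (uA : uniq A) (uB : uniq B) (z_gt0 : (0 < z)%N).
Hypothesis AB : forall p, p \in A -> (p <= z)%N -> p \in B.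
Hypothesis B_le : forall p, p \in B -> (0 < p <= z)%N.
Let A1 := [seq p <- A | (p <= z)%N].
Let A2 := [seq p <- A | ~~ (p <= z)%N].
Let B2 := [seq p <- B | p \notin A].

Let perm_A : perm_eq A (A1 ++ A2). Proof. by rewrite perm_sym perm_filterC. Qed.

Let perm_B : perm_eq B (A1 ++ B2).
Proof.
rewrite perm_sym; apply: perm_trans (permEl (perm_filterC (mem A) B)).
rewrite perm_cat2r; apply: uniq_perm; rewrite ?filter_uniq //.
move=> p; rewrite !mem_filter; apply/andP/andP => -[].
  by move=> pz pA; split; [exact: pA | exact: AB].
by move=> pA /B_le /andP[_ pz]; split.
Qed.

(** Exchange argument: after the common part [A1] is cancelled, the rest of [A] lies above [z], the
    rest of [B] at or below it, and the rest of [A] is not longer. *)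
Lemma sum_inv_smallest_le : (size A <= size B)%N ->
  \sum_(p <- A) p%:R^-1 <= \sum_(p <- B) p%:R^-1 :> rat.
Proof.
rewrite (perm_size perm_A) (perm_size perm_B) !size_cat leq_add2l => leAB.
rewrite (perm_big _ perm_A) (perm_big _ perm_B) !big_cat lerD2l /=.
have zV : 0 < z%:R :> rat by rewrite ltr0n.
apply: (@le_trans _ _ (z%:R^-1 *+ size A2)).
  rewrite -iter_addr_0 -count_predT -big_const_seq.
  rewrite big_seq [X in _ <= X]big_seq; apply: ler_sum => p.
  rewrite mem_filter -ltnNge => /andP[zp _].
  by rewrite lef_pV2 ?posrE ?ler_nat ?ltr0n ?(ltnW zp) // (leq_trans _ zp).
apply: (@le_trans _ _ (z%:R^-1 *+ size B2)); first by rewrite ler_wpMn2l // invr_ge0 ltW.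
rewrite -iter_addr_0 -count_predT -big_const_seq.
rewrite big_seq [X in _ <= X]big_seq; apply: ler_sum => p.
rewrite mem_filter => /andP[_ /B_le /andP[p_gt0 pz]].
by rewrite lef_pV2 ?posrE ?ler_nat ?ltr0n.
Qed.

(** Same exchange; the surplus element of [A] contributes the extra factor [z]. This makes [n] large
    when a cutoff fails. *)
Lemma prod_smallest_le : (size B < size A)%N ->
  (\prod_(p <- B) p * z <= \prod_(p <- A) p)%N.
Proof.
rewrite (perm_size perm_A) (perm_size perm_B) !size_cat ltn_add2l => ltAB.
rewrite (perm_big _ perm_A) (perm_big _ perm_B) !big_cat -mulnA leq_mul2l /=.
apply/orP; right; apply: (@leq_trans (z ^ (size B2).+1)).
  rewrite expnSr leq_mul2r; apply/orP; right.
  rewrite -iter_muln_1 -(count_predT B2) -big_const_seq.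
  rewrite big_seq [X in (_ <= X)%N]big_seq; apply: leq_prod => p.
  by rewrite mem_filter => /andP[_ /B_le /andP[]].
apply: (@leq_trans (z ^ size A2)); first by rewrite leq_pexp2l.
rewrite -iter_muln_1 -(count_predT A2) -big_const_seq.
rewrite big_seq [X in (_ <= X)%N]big_seq; apply: leq_prod => p.
by rewrite mem_filter -ltnNge => /andP[/ltnW].
Qed.

End Smallest.

Section FixedCutoff.
Variables (n R y z : nat).
Hypothesis z_gt0 : (0 < z)%N.
Let small := [seq p <- primes n | (p <= y)%N].
Let large := [seq p <- primes n | (y < p)%N].
Let smallest := primes_upto y.
Let next := primes_between y z.

Let E : rat := \prod_(p <- smallest) p%:R.
Let Phi : rat := \prod_(p <- smallest) (p%:R - 1).

Let small_prime : all prime small.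
Proof. by apply/allP => p; rewrite mem_filter mem_primes => /and3P[]. Qed.
Let small_uniq : uniq small. Proof. exact/filter_uniq/primes_uniq. Qed.
Let large_uniq : uniq large. Proof. exact/filter_uniq/primes_uniq. Qed.
Let smallest_uniq : uniq smallest. Proof. exact/filter_uniq/iota_uniq. Qed.
Let next_uniq : uniq next. Proof. exact/filter_uniq/iota_uniq. Qed.
Let smallest_prime : all prime smallest. Proof. exact: filter_all. Qed.
Let small_sub : {subset small <= smallest}.
Proof.
move=> p; rewrite !mem_filter mem_primes => /andP[py /and3P[-> _ _]].
by rewrite mem_iota /= add0n ltnS.
Qed.

Let prime_ge2 p : prime p -> 2 <= p%:R :> rat.
Proof. by move=> /prime_gt1; rewrite -(ler_nat rat). Qed.

Lemma cutoff_prod_le : (\prod_(p <- small) p)%N%:R <= E.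
Proof.
rewrite prod_primesE; apply: ler_prod_subseq => // p /(allP smallest_prime)/prime_ge2; lra.
Qed.

Lemma cutoff_totient_le : (totient (\prod_(p <- small) p))%:R <= Phi.
Proof.
rewrite totient_prod_primes // prod_predE //.
by apply: ler_prod_subseq => // p /(allP smallest_prime)/prime_ge2; lra.
Qed.

Lemma prod_primes_gt0 s : all prime s -> 0 < \prod_(p <- s) p%:R :> rat.
Proof.
move=> /allP sP; rewrite big_seq; apply: prodr_gt0 => p /sP/prime_ge2; lra.
Qed.

Lemma prod_pred_primes_gt0 s : all prime s -> 0 < \prod_(p <- s) (p%:R - 1) :> rat.
Proof.
move=> /allP sP; rewrite big_seq; apply: prodr_gt0 => p /sP/prime_ge2; lra.
Qed.

Lemma cutoff_ratio_ge : Phi / E <=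
  (totient (\prod_(p <- small) p))%:R / (\prod_(p <- small) p)%N%:R.
Proof.
rewrite totient_prod_primes // prod_predE // prod_primesE /Phi /E.
rewrite !prod_one_sub_inv // lef_pV2 ?posrE ?prodf_div ?divr_gt0
  ?prod_primes_gt0 ?prod_pred_primes_gt0 // -!prodf_div.
apply: ler_prod_subseq => // p /(allP smallest_prime)/prime_ge2 p2.
by rewrite ler_pdivlMr; lra.
Qed.

Let large_next p : p \in large -> (p <= z)%N -> p \in next.
Proof.
rewrite !mem_filter mem_primes => /andP[yp /and3P[-> _ _]] pz.
by rewrite mem_iota yp /=; lia.
Qed.

Let next_le p : p \in next -> (0 < p <= z)%N.
Proof. by rewrite mem_filter mem_iota => /andP[/prime_gt0 -> /=]; lia. Qed.

Lemma sum_inv_large_le : (size large <= size next)%N ->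
  \sum_(l <- large) l%:R^-1 <= \sum_(p <- next) p%:R^-1 :> rat.
Proof. exact: (sum_inv_smallest_le large_uniq next_uniq z_gt0 large_next next_le). Qed.

Lemma prod_next_le : (0 < n)%N -> (size next < size large)%N ->
  (\prod_(p <- next) p%:R * z%:R <= n%:R :> rat).
Proof.
move=> n_gt0 lt; rewrite -natr_prod -natrM ler_nat.
have le := prod_smallest_le large_uniq next_uniq z_gt0 large_next next_le lt.
apply: leq_trans le _; apply: dvdn_leq n_gt0 _; apply: dvdn_prod_primes => //.
  by apply/allP => p; rewrite mem_filter mem_primes => /and3P[].
by apply/allP => p; rewrite mem_filter mem_primes => /and4P[].
Qed.

(** The worst case is that all primes up to [y] divide [n]: this maximizes [e] and its totient and
    minimizes their ratio. The main term is at least [kappa * Q] and the error at most [(kappa -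
    eta) * R ^ 2 <= (kappa - eta) * Q]; one half of the reserve [eta * Q] pays for [12 * Q / q], the
    other for the 3. *)
Lemma sieve_bound_cutoff (kappa eta : rat) (q : nat) : (0 < n)%N ->
  let W := size next in let S := \sum_(p <- next) p%:R^-1 : rat in
  (size large <= W)%N -> 2 * S <= 1 -> kappa <= (Phi / E) ^+ 2 * (1 - 2 * S) ->
  E ^+ 2 <= R%:R ->
  25 * E ^+ 2 + W%:R * (50 * Phi ^+ 2 + 4 * E ^+ 2) <= (kappa - eta) * R%:R ->
  (R ^ 2 <= n.+1)%N -> 0 < kappa - eta -> 12 / q%:R <= eta / 2 -> 3 < eta / 2 * n.+1%:R ->
  sieve_exists n R q.
Proof.
move=> n_gt0 W S leW S1 leK leER leC leRn ke qe n3.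
exists (\prod_(p <- small) p)%N, large; split.
  apply: sieve_admissible_prod => //.
  - rewrite cat_uniq small_uniq large_uniq andbT /=; apply/hasPn => p.
    by rewrite !mem_filter => /andP[yp _]; rewrite leqNgt yp.
  - by move=> p; rewrite mem_cat !mem_filter; case: leqP => _; rewrite /= ?orbF.
  rewrite -(ler_nat rat) natrM -expr2; apply: le_trans leER.
  by rewrite ler_pXn2r ?nnegrE ?ler0n // ?cutoff_prod_le // ltW // prod_primes_gt0.
have := cutoff_prod_le; have := cutoff_totient_le; have := cutoff_ratio_ge.
rewrite /sieve_bound; move: (totient _) => phi; set e := (\prod_(p <- small) p)%N.
move=> leratio lephi lee.
have E_gt0 : 0 < E by apply: prod_primes_gt0.
have Phi_gt0 : 0 < Phi by apply: prod_pred_primes_gt0.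
have e_gt0 : 0 < e%:R :> rat by rewrite /e prod_primesE prod_primes_gt0.
have N0 : 0 < n.+1%:R :> rat by rewrite ltr0n.
have main : kappa * n.+1%:R <=
   phi%:R ^+ 2 * n.+1%:R / e%:R ^+ 2 * (1 - 2 * \sum_(l <- large) l%:R^-1).
  have -> : phi%:R ^+ 2 * n.+1%:R / e%:R ^+ 2 * (1 - 2 * \sum_(l <- large) l%:R^-1)
    = (phi%:R / e%:R) ^+ 2 * (1 - 2 * \sum_(l <- large) l%:R^-1) * n.+1%:R :> rat.
    by field; rewrite gt_eqF.
  rewrite ler_pM2r //; apply: le_trans leK _.
  apply: ler_pM; rewrite ?exprn_ge0 ?divr_ge0 ?(ltW E_gt0) ?(ltW Phi_gt0) //.
  - by rewrite subr_ge0.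
  - by rewrite ler_pXn2r ?nnegrE ?divr_ge0 ?ler0n ?(ltW E_gt0) ?(ltW Phi_gt0).
  - by rewrite lerB // ler_pM2l // sum_inv_large_le.
have sW : (size large)%:R <= W%:R :> rat by rewrite ler_nat.
have w_ge0 : 0 <= (size large)%:R :> rat by rewrite ler0n.
move: main leC leER lephi lee E_gt0 Phi_gt0 sW w_ge0; move: (\sum_(l <- large) _) => T.
move: (size large)%:R W%:R => w w0; clearbody E Phi e; clear - n_gt0 leRn ke qe n3 e_gt0 N0.
move=> main leC leER lephi lee E_gt0 Phi_gt0 sW w_ge0.
have e2 : e%:R ^+ 2 <= E ^+ 2 by rewrite ler_pXn2r ?nnegrE ?ler0n ?(ltW E_gt0).
have phi2 : phi%:R ^+ 2 <= Phi ^+ 2.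
  by rewrite ler_pXn2r ?nnegrE ?ler0n ?(ltW Phi_gt0).
have error : 25 * e%:R ^+ 2 + w * (50 * phi%:R ^+ 2 + 4 * e%:R ^+ 2)
    <= 25 * E ^+ 2 + w0 * (50 * Phi ^+ 2 + 4 * E ^+ 2).
  apply: lerD; first by rewrite ler_pM2l.
  have sq0 (k : nat) : 0 <= k%:R ^+ 2 :> rat by rewrite exprn_ge0 ?ler0n.
  have := sq0 phi; have := sq0 e => e20 phi20.
  by apply: (ler_pM w_ge0 _ sW _); lra.
have R0 : 0 <= R%:R :> rat := ler0n _ _.
have errorR := ler_wpM2r R0 (le_trans error leC).
have R2 : (kappa - eta) * (R%:R * R%:R) <= (kappa - eta) * n.+1%:R.
  by rewrite ler_pM2l // -natrM ler_nat mulnn.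
have q2 : 12 / q%:R * n.+1%:R <= eta / 2 * n.+1%:R by rewrite ler_pM2r.
rewrite mulrAC; move: errorR main R2 q2 n3; rewrite -[_ * R%:R * R%:R]mulrA.
move: (_ * (1 - 2 * T)) ((25 * _ + _) * R%:R) => X Y; lra.
Qed.

End FixedCutoff.

(** * Numerical verification at the three cutoffs *)

Lemma leq_sqrt_floor (n R c : nat) :
  (n.+1 < R.+1 ^ 2)%N -> c%:R ^+ 2 <= n.+1%:R :> rat -> c%:R <= R%:R :> rat.
Proof.
move=> ltR; rewrite -natrX !ler_nat => leR; rewrite -ltnS -(@ltn_exp2r c R.+1 2) //.
exact: leq_ltn_trans leR ltR.
Qed.

Definition cutoff_numeric (y z : nat) (kappa eta r N : rat) : Prop :=
  let E := \prod_(p <- primes_upto y) p%:R in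
  let Phi := \prod_(p <- primes_upto y) (p%:R - 1) in
  let S := \sum_(p <- primes_between y z) p%:R^-1 in
  [/\ 2 * S <= 1, kappa <= (Phi / E) ^+ 2 * (1 - 2 * S), E ^+ 2 <= r,
      25 * E ^+ 2 + (size (primes_between y z))%:R * (50 * Phi ^+ 2 + 4 * E ^+ 2)
        <= (kappa - eta) * r &
      0 < kappa - eta /\ 3 < eta / 2 * N].

Lemma twelve_div_le (x : rat) : 1271 * 10 ^+ 5 < x -> 12 / x <= 1 / 10 ^+ 6 / 2.
Proof.
move=> x_big; have x_gt0 : 0 < x by lra.
by rewrite (ler_pdivrMr _ _ x_gt0); lra.
Qed.

Lemma cutoff_step (n R q y z : nat) (kappa : rat) : (0 < z)%N -> (0 < n)%N ->
  (R ^ 2 <= n.+1)%N -> 1271 * 10 ^+ 5 < q%:R :> rat ->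
  cutoff_numeric y z kappa (1 / 10 ^+ 6) R%:R n.+1%:R ->
  sieve_exists n R q \/
  \prod_(p <- primes_between y z) p%:R * z%:R <= n%:R :> rat /\
  (size (primes_between y z) < size (primes n))%N.
Proof.
move=> z_gt0 n_gt0 leR q_big [S1 leK leE leC [ke n3]].
have [leW|ltW] := leqP (size [seq p <- primes n | (y < p)%N]) (size (primes_between y z)).
  left; apply: (@sieve_bound_cutoff n R y z z_gt0 kappa _ q n_gt0 leW S1 leK leE leC leR ke _ n3).
  exact (twelve_div_le q_big).
right; split; first exact: (@prod_next_le n y z z_gt0 n_gt0 ltW).
apply: (leq_trans ltW); rewrite size_filter; exact (count_size _ _).
Qed.

Lemma primes_upto_13 : primes_upto 13 = [:: 2; 3; 5; 7; 11; 13]%N.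
Proof. by vm_compute. Qed.

Lemma primes_between_13_103 : primes_between 13 103 =
  [:: 17; 19; 23; 29; 31; 37; 41; 43; 47; 53; 59; 61; 67; 71; 73; 79; 83;
     89; 97; 101; 103]%N.
Proof. by vm_compute. Qed.

(** [kappa] is (Phi / E)^2 (1 - 2 S) rounded down, with 2 S about 0.957. The error coefficient
    divided by [r] is at most about 0.00142, against the 0.001588 available. *)
Lemma cutoff_numeric_13 (r N : rat) : 94 * 10 ^+ 12 <= r -> r ^+ 2 <= N ->
  cutoff_numeric 13 103 (1589 / 10 ^+ 6) (1 / 10 ^+ 6) r N.
Proof.
move=> r_big N_big; have {}N_big : 94 * 10 ^+ 12 <= N by nra.
rewrite /cutoff_numeric primes_upto_13 primes_between_13_103 !big_cons !big_nil.
cbv zeta; rewrite [size _]/=; split.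
- lra.
- lra.
- lra.
- lra.
- split; lra.
Qed.

Lemma primes_upto_19 : primes_upto 19 = [:: 2; 3; 5; 7; 11; 13; 17; 19]%N.
Proof. by vm_compute. Qed.

Lemma primes_between_19_163 : primes_between 19 163 =
  [:: 23; 29; 31; 37; 41; 43; 47; 53; 59; 61; 67; 71; 73; 79; 83; 89; 97;
     101; 103; 107; 109; 113; 127; 131; 137; 139; 149; 151; 157; 163]%N.
Proof. by vm_compute. Qed.

Lemma cutoff_numeric_19 (r N : rat) : 9 * 10 ^+ 18 <= r -> r ^+ 2 <= N ->
  cutoff_numeric 19 163 (2915 / 10 ^+ 6) (1 / 10 ^+ 6) r N.
Proof.
move=> r_big N_big; have {}N_big : 9 * 10 ^+ 18 <= N by nra.
rewrite /cutoff_numeric primes_upto_19 primes_between_19_163 !big_cons !big_nil.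
cbv zeta; rewrite [size _]/=; split.
- lra.
- lra.
- lra.
- lra.
- split; lra.
Qed.

Lemma primes_upto_31 : primes_upto 31 = [:: 2; 3; 5; 7; 11; 13; 17; 19; 23; 29; 31]%N.
Proof. by vm_compute. Qed.

Lemma primes_between_31_409 : primes_between 31 409 =
  [:: 37; 41; 43; 47; 53; 59; 61; 67; 71; 73; 79; 83; 89; 97; 101; 103;
     107; 109; 113; 127; 131; 137; 139; 149; 151; 157; 163; 167; 173;
     179; 181; 191; 193; 197; 199; 211; 223; 227; 229; 233; 239; 241;
     251; 257; 263; 269; 271; 277; 281; 283; 293; 307; 311; 313; 317;
     331; 337; 347; 349; 353; 359; 367; 373; 379; 383; 389; 397; 401;
     409]%N.
Proof. by vm_compute. Qed.

Lemma cutoff_numeric_31 (r N : rat) : 31 * 10 ^+ 28 <= r -> r ^+ 2 <= N ->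
  cutoff_numeric 31 409 (92 / 10 ^+ 6) (1 / 10 ^+ 6) r N.
Proof.
move=> r_big N_big; have {}N_big : 31 * 10 ^+ 28 <= N by nra.
rewrite /cutoff_numeric primes_upto_31 primes_between_31_409 !big_cons !big_nil.
cbv zeta; rewrite [size _]/=; split.
- lra.
- lra.
- lra.
- lra.
- split; lra.
Qed.

(** * Elementary upper bounds for the number of primes *)

Definition prime_count (x : nat) : nat := count prime (iota 0 x.+1).

(** Sliding the window by one exchanges [x] for [x + 210], which has the same residue; 48 is the
    totient of 210. *)
Lemma count_coprime_210 x : count (coprime 210) (iota x 210) = 48%N.
Proof.
elim: x => [|x IHx]; first by vm_compute.
rewrite -[RHS]IHx; apply/eqP; rewrite -(eqn_add2l (coprime 210 x)).
have -> : (coprime 210 x + count (coprime 210) (iota x.+1 210) =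
  count (coprime 210) (iota x 211))%N by [].
have -> : iota x 211 = iota x 210 ++ [:: (x + 210)%N] by rewrite -[211%N]addn1 iotaD.
by rewrite count_cat [count _ [:: _]]/= addn0 -(coprime_modr _ (x + 210)) modnDr coprime_modr addnC.
Qed.

Lemma prime_coprime_210 p : prime p -> (7 < p)%N -> coprime 210 p.
Proof.
move=> p_pr p7; rewrite coprime_sym prime_coprime //; apply/negP => p210.
have : p \in primes 210 by rewrite mem_primes p_pr p210.
have -> : primes 210 = [:: 2; 3; 5; 7]%N by vm_compute.
by rewrite !inE; lia.
Qed.

(** The slope 8/35 is 48/210. Induction goes down by 210; from 220 on, the primes in the removed
    window exceed 7 and so are prime to 210. The constant 152 covers the computed range. *)
Lemma prime_count_wheel x : (35 * prime_count x <= 8 * x + 152)%N.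
Proof.
elim/ltn_ind: x => x IHx.
have [ltx|lex] := ltnP x 220.
  have /allP small : all (fun y => 35 * prime_count y <= 8 * y + 152)%N (iota 0 220).
    by vm_compute.
  by apply: small; rewrite mem_iota.
have xE : x = (x - 210 + 210)%N by rewrite subnK // (leq_trans _ lex).
set y := (x - 210)%N in xE; have := IHx y; rewrite /prime_count xE -addSn iotaD count_cat add0n.
have : (count prime (iota y.+1 210) <= count (coprime 210) (iota y.+1 210))%N.
  rewrite -!size_filter; apply: uniq_leq_size; first exact/filter_uniq/iota_uniq.
  move=> p; rewrite !mem_filter mem_iota => /andP[p_pr /andP[yp py]].
  by rewrite yp py prime_coprime_210 //; lia.
rewrite count_coprime_210; move: (count _ _) (count _ _) => c1 c2; lia.
Qed.

Lemma prime_count_half x : (2 <= x)%N -> (2 * prime_count x <= x + 1)%N.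
Proof.
move=> x2; have [ltx|lex] := ltnP x 20; last by have := prime_count_wheel x; lia.
have /allP small : all (fun y => 2 * prime_count y <= y + 1)%N (iota 2 18).
  by vm_compute.
by apply: small; rewrite mem_iota x2.
Qed.

Lemma nth_primes_count n i : (i < size (primes n))%N ->
  (i < prime_count (nth 0%N (primes n) i))%N.
Proof.
move=> lti; rewrite /prime_count -size_filter.
have -> : i.+1 = size (take i.+1 (primes n)) by rewrite size_takel.
apply: uniq_leq_size; first exact/take_uniq/primes_uniq.
move=> p pt; rewrite mem_filter mem_iota add0n ltnS.
have := mem_take pt; rewrite mem_primes => /and3P[-> _ _] /=.
case/(nthP 0%N): pt => j; rewrite size_takel // ltnS => leji <-.
rewrite nth_take //; move: leji; rewrite leq_eqVlt => /orP[/eqP -> //|ltji].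
apply/ltnW/(sorted_ltn_nth ltn_trans 0%N (sorted_primes n)) => //.
by rewrite inE (ltn_trans ltji).
Qed.

(* [prime_count_wheel] makes the [i]-th prime (counted from 0) at least
   [(35 * i - 117) / 8]. *)
Definition wheel_inv (i : nat) : rat := 8 / (35 * i - 117)%N%:R.

Lemma wheel_inv_ge0 i : 0 <= wheel_inv i.
Proof. by apply: mulr_ge0; rewrite ?invr_ge0 ler0n. Qed.

Lemma wheel_invE i : (4 <= i)%N -> wheel_inv i = 8 / (35 * i%:R - 117).
Proof. by move=> i4; rewrite /wheel_inv natrB ?natrM //; lia. Qed.

(** The sum is cut into blocks of ten, each rounded up to a short decimal, to keep common
    denominators small. *)
Lemma sum_wheel_inv_14 : \sum_(14 <= i < 74) wheel_inv i <= 445 / 1000.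
Proof.
rewrite -(big_map (fun i => 35 * i - 117)%N xpredT (fun d : nat => 8 / d%:R)) -mulr_sumr.
have -> : [seq (35 * i - 117)%N | i <- index_iota 14 74] =
  [:: 373; 408; 443; 478; 513; 548; 583; 618; 653; 688]%N ++
  [:: 723; 758; 793; 828; 863; 898; 933; 968; 1003; 1038]%N ++
  [:: 1073; 1108; 1143; 1178; 1213; 1248; 1283; 1318; 1353; 1388]%N ++
  [:: 1423; 1458; 1493; 1528; 1563; 1598; 1633; 1668; 1703; 1738]%N ++
  [:: 1773; 1808; 1843; 1878; 1913; 1948; 1983; 2018; 2053; 2088]%N ++
  [:: 2123; 2158; 2193; 2228; 2263; 2298; 2333; 2368; 2403; 2438]%N.
  by vm_compute.
have catE (s1 s2 : seq nat) : \sum_(d <- s1 ++ s2) d%:R^-1 =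
    \sum_(d <- s1) d%:R^-1 + \sum_(d <- s2) d%:R^-1 :> rat by rewrite big_cat.
rewrite !catE.
have h0 : \sum_(d <- [:: 373; 408; 443; 478; 513; 548; 583; 618; 653; 688]%N)
    d%:R^-1 <= 1958 / 10 ^+ 5 :> rat.
  by rewrite !big_cons big_nil; lra.
have h1 : \sum_(d <- [:: 723; 758; 793; 828; 863; 898; 933; 968; 1003; 1038]%N)
    d%:R^-1 <= 1151 / 10 ^+ 5 :> rat.
  by rewrite !big_cons big_nil; lra.
have h2 : \sum_(d <- [:: 1073; 1108; 1143; 1178; 1213; 1248; 1283; 1318; 1353; 1388]%N)
    d%:R^-1 <= 819 / 10 ^+ 5 :> rat.
  by rewrite !big_cons big_nil; lra.
have h3 : \sum_(d <- [:: 1423; 1458; 1493; 1528; 1563; 1598; 1633; 1668; 1703; 1738]%N)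
    d%:R^-1 <= 636 / 10 ^+ 5 :> rat.
  by rewrite !big_cons big_nil; lra.
have h4 : \sum_(d <- [:: 1773; 1808; 1843; 1878; 1913; 1948; 1983; 2018; 2053; 2088]%N)
    d%:R^-1 <= 520 / 10 ^+ 5 :> rat.
  by rewrite !big_cons big_nil; lra.
have h5 : \sum_(d <- [:: 2123; 2158; 2193; 2228; 2263; 2298; 2333; 2368; 2403; 2438]%N)
    d%:R^-1 <= 440 / 10 ^+ 5 :> rat.
  by rewrite !big_cons big_nil; lra.
move: h0 h1 h2 h3 h4 h5; do 6 move: (bigop _ _ _).
by move=> ? ? ? ? ? ?; lra.
Qed.

(** The sum does not grow with [k]: passing to [k + 1] removes [wheel_inv k] and adds five terms
    with indices from [5 * k + 4] on, each at most a fifth of it. *)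
Lemma sum_wheel_inv_le k : (14 <= k)%N ->
  \sum_(k <= i < 5 * k + 4) wheel_inv i <= 445 / 1000.
Proof.
move=> /subnKC <-; elim: (k - 14)%N => [|m IHm].
  by rewrite addn0; exact: sum_wheel_inv_14.
rewrite addnS; move: (14 + m)%N (leq_addr m 14) IHm => {}k k14 IHk.
apply: le_trans IHk.
have -> : (5 * k.+1 + 4 = (5 * k + 4).+1.+4)%N by lia.
rewrite [X in _ <= X]big_ltn; last by lia.
rewrite !(@big_nat_recr _ _ _ _ k.+1); try lia.
have kR : 14 <= k%:R :> rat by rewrite (ler_nat _ 14).
have le i : wheel_inv (5 * k + 4 + i) <= wheel_inv k / 5.
  rewrite !wheel_invE; try lia.
  rewrite natrD natrD natrM.
  have := ler0n rat i; move: k%:R i%:R kR => x y x14 y0.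
  have d0 : 0 < 35 * (5 * x + 4 + y) - 117 by lra.
  have d1 : 0 < 35 * x - 117 by lra.
  have -> : 8 / (35 * x - 117) / 5 = 8 / (5 * (35 * x - 117)).
    by field; rewrite gt_eqF.
  have lef : 5 * (35 * x - 117) <= 35 * (5 * x + 4 + y) - 117 by lra.
  have h0 : 0 < 5 * (35 * x - 117) by lra.
  apply: ler_wpM2l; first by lra.
  by rewrite lef_pV2 ?posrE.
have := le 0%N; have := le 1%N; have := le 2%N; have := le 3%N; have := le 4%N.
rewrite !addnS !addn0 /=; move: (wheel_inv k) => a; lra.
Qed.

(** * Integers with at least 70 prime divisors *)

Lemma sqr_le_step (u v b p : rat) : 0 <= v -> v <= 4 * u -> u ^+ 2 <= b -> 16 <= p ->
  v ^+ 2 <= b * p.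
Proof.
move=> v0 uv leb p16; have b0 : 0 <= b by apply: le_trans leb; apply: sqr_ge0.
have v2 : v ^+ 2 <= 16 * u ^+ 2 by nra.
have := ler_wpM2l b0 p16; lra.
Qed.

(** Raising [x] by 1 at most quadruples the unsquared factor, so its square grows at most 16-fold,
    less than the new prime [p], which is at least 29. *)
Lemma error_factor_step (x b p : rat) : 14 <= x ->
  (1000 * (5 * x + 4) * (x + 1) ^+ 2) ^+ 2 <= b -> 2 * x + 1 <= p ->
  (1000 * (5 * (x + 1) + 4) * (x + 1 + 1) ^+ 2) ^+ 2 <= b * p.
Proof.
move=> x14 leb lep.
have step : 1000 * (5 * (x + 1) + 4) * (x + 1 + 1) ^+ 2 <=
    4 * (1000 * (5 * x + 4) * (x + 1) ^+ 2).
  have h1 : 5 * (x + 1) + 4 <= 2 * (5 * x + 4) by lra.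
  have h2 : (x + 1 + 1) ^+ 2 <= 2 * (x + 1) ^+ 2 by nra.
  have h3 : 0 <= 1000 * (5 * (x + 1) + 4) by lra.
  have h4 : 0 <= (x + 1 + 1) ^+ 2 by apply: exprn_ge0; lra.
  have h5 : 1000 * (5 * (x + 1) + 4) <= 1000 * (2 * (5 * x + 4)) by lra.
  by apply: le_trans (ler_pM h3 h4 h5 h2) _; lra.
have pos : 0 <= 1000 * (5 * (x + 1) + 4) * (x + 1 + 1) ^+ 2.
  by apply: mulr_ge0; [lra | apply: exprn_ge0; lra].
by apply: (sqr_le_step pos step leb); lra.
Qed.

(** In units of [N / c]: the main term is at least 0.11, since [1 - 2 * t >= 0.11] and
    [phi / E >= 1 / (x + 1)]; the error is at most 0.055, because its coefficient is at most
    [55 * (5 * x + 4) * E ^ 2] and [K] carries 1000 in place of 55; the 3 and the [12 * N / q] cost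
    at most 0.01 each. *)
Lemma sieve_bound_margin (F : realFieldType) (x c K N E phi w r t q : F) :
  14 <= x -> c = (x + 1) ^+ 2 -> K = 1000 * (5 * x + 4) * c -> 0 < E -> 0 <= r ->
  K ^+ 2 <= E -> E <= N -> E <= q -> K * E ^+ 2 * r <= N ->
  0 <= phi -> phi <= E -> E <= phi * (x + 1) -> 0 <= w -> w <= 4 * x + 4 ->
  t <= 445 / 1000 ->
  12 * N / q < phi ^+ 2 * N / E ^+ 2 * (1 - 2 * t)
    - (25 * E ^+ 2 + w * (50 * phi ^+ 2 + 4 * E ^+ 2)) * r - 3.
Proof.
move=> x14 cE KE E0 r0 leKE leEN leEq leKN phi0 lephi leE w0 lew let445.
have c0 : 225 <= c by rewrite cE; nra.
have c_gt0 : 0 < c by clear - c0; lra.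
have cV : 0 < c^-1 by rewrite invr_gt0.
have K_big : 1000 * 74 * c <= K by rewrite KE; clear - x14 c0; nra.
have K1 : K <= K ^+ 2 by clear - c0 K_big; nra.
have K0 : 0 <= K by clear - c0 K_big; lra.
have N0 : 0 < N := lt_le_trans E0 leEN.
have q0 : 0 < q := lt_le_trans E0 leEq.
have cN : 0 < c^-1 * N := mulr_gt0 cV N0.
have cne : c != 0 by rewrite gt_eqF.
have phiE : phi ^+ 2 <= E ^+ 2 by rewrite ler_pXn2r ?nnegrE // ltW.
have E2 : 0 <= E ^+ 2 := sqr_ge0 E.
have phi2 : 0 <= phi ^+ 2 := sqr_ge0 phi.
have main : c^-1 * N * (11 / 100) <= phi ^+ 2 * N / E ^+ 2 * (1 - 2 * t).
  apply: (ler_pM (ltW cN)); [by clear; lra | | by clear - let445; lra].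
  rewrite mulrAC ler_wpM2r ?(ltW N0) //.
  have x1 : 0 < x + 1 by clear - x14; lra.
  have ratio : (x + 1)^-1 <= phi / E.
    by rewrite ler_pdivlMr // mulrC ler_pdivrMr.
  rewrite cE -exprVn -exprVn -exprMn; apply: lerXn2r ratio; rewrite nnegrE.
    by rewrite invr_ge0 ltW.
  by rewrite mulr_ge0 // invr_ge0 ltW.
have err : (25 * E ^+ 2 + w * (50 * phi ^+ 2 + 4 * E ^+ 2)) * r <= c^-1 * N * (55 / 1000).
  apply: (@le_trans _ _ (55 * (5 * x + 4) * E ^+ 2 * r)).
    apply: ler_wpM2r => //.
    have h1 : w * (50 * phi ^+ 2 + 4 * E ^+ 2) <= (4 * x + 4) * (54 * E ^+ 2).
      by apply: (ler_pM w0 _ lew); clear - phiE E2 phi2; lra.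
    have x0 : 0 <= x - 14 by rewrite subr_ge0.
    apply: le_trans (lerD (lexx _) h1) _; have := mulr_ge0 x0 E2.
    by clear - E2; move: (E ^+ 2) E2 => z z0; lra.
  have -> : 55 * (5 * x + 4) * E ^+ 2 * r = c^-1 * (K * E ^+ 2 * r) * (55 / 1000).
    by rewrite KE; field.
  apply: ler_wpM2r; first by clear; lra.
  by apply: ler_wpM2l leKN; apply: ltW.
have three : 3 <= c^-1 * N * (1 / 100).
  have : 300 <= c^-1 * N.
    by rewrite mulrC ler_pdivlMr //; clear - leKE leEN K1 K_big c0; lra.
  by clear; lra.
have twelve : 12 * N / q <= c^-1 * N * (1 / 100).
  rewrite mulrAC [c^-1 * N * _]mulrAC ler_pM2r // ler_pdivrMr //.
  have -> : c^-1 * (1 / 100) * q = q / (100 * c) by field.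
  by rewrite ler_pdivlMr; clear - leKE leEq K1 K_big c0; lra.
move: main err three twelve cN; move: (c^-1 * N) (12 * N / q) => cN z.
by move: (_ * (1 - _)) (_ * r) => y v; clear; lra.
Qed.

(* The [k] smallest of at least [5 * k] primes have a product at most
   [n ^ (1/5)], whose square is small against [R]. *)
Section ManyPrimes.
Variables (n R q k : nat).
Let ps := primes n.
Let s := take k ps.
Let L := drop k ps.
Hypothesis n_gt0 : (0 < n)%N.
Hypotheses (k14 : (14 <= k)%N) (lek : (5 * k <= size ps)%N) (ltk : (size ps < 5 * k + 5)%N).
Hypotheses (leR : (R ^ 2 <= n.+1)%N) (ltR : (n.+1 < R.+1 ^ 2)%N) (leq4 : (n.+1 <= q ^ 4)%N).

Let lekN : (k <= size ps)%N. Proof. lia. Qed.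
Let size_s : size s = k. Proof. by rewrite size_takel. Qed.
Let s_cat_L : s ++ L = ps. Proof. exact: cat_take_drop. Qed.
Let ps_prime p : p \in ps -> prime p. Proof. by rewrite mem_primes => /and3P[]. Qed.
Let s_prime : all prime s. Proof. by apply/allP => p /mem_take/ps_prime. Qed.
Let s_uniq : uniq s. Proof. exact/take_uniq/primes_uniq. Qed.
Let e := (\prod_(p <- s) p)%N.

Let nth_ps_prime i : (i < size ps)%N -> prime (nth 0%N ps i).
Proof. by move=> lti; apply/ps_prime/mem_nth. Qed.

Lemma nth_primes_wheel i : (i < size ps)%N -> (35 * i.+1 <= 8 * nth 0%N ps i + 152)%N.
Proof.
move=> lti; apply: leq_trans (prime_count_wheel _).
by rewrite leq_mul2l nth_primes_count.
Qed.

Lemma nth_primes_half i : (i < size ps)%N -> (2 * i + 1 <= nth 0%N ps i)%N.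
Proof.
move=> lti; have := prime_count_half (prime_gt1 (nth_ps_prime lti)).
by have := nth_primes_count lti; rewrite -/ps; lia.
Qed.

Let e_gt0 : (0 < e)%N.
Proof.
by rewrite /e big_seq; apply: prodn_cond_gt0 => p /(allP s_prime)/prime_gt0.
Qed.

Lemma pow5_prod_primes_le : (e ^ 5 <= n)%N.
Proof.
(* A pivot: the [k] primes of [s] are at most [M], and the at least [4 * k] primes of [L] are at
   least [M], so their product is at least [e ^ 4]. *)
pose M := nth 0%N ps k.
have leM p : p \in s -> (p <= M)%N.
  case/(nthP 0%N) => i; rewrite size_s => ltik <-; rewrite nth_take //.
  by apply/ltnW/(sorted_ltn_nth ltn_trans 0%N (sorted_primes n)) ; rewrite ?inE -/ps; lia.
have Mle p : p \in L -> (M <= p)%N.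
  case/(nthP 0%N) => i; rewrite size_drop => lti <-; rewrite nth_drop.
  have [->|i_gt0] := posnP i; first by rewrite addn0.
  have ltki : (k + i < size ps)%N by rewrite -ltn_subRL.
  apply/ltnW/(sorted_ltn_nth ltn_trans 0%N (sorted_primes n)); rewrite ?inE //.
    exact: leq_ltn_trans (leq_addr _ _) ltki.
  by rewrite -{1}[k]addn0 ltn_add2l.
have M_gt0 : (0 < M)%N by apply/prime_gt0/nth_ps_prime; lia.
have eM : (e <= M ^ k)%N.
  rewrite -[in X in (_ <= X)%N]size_s -iter_muln_1 -(count_predT s) -big_const_seq.
  rewrite /e big_seq [X in (_ <= X)%N]big_seq; apply: leq_prod => p; exact: leM.
have ML : (M ^ (4 * k) <= \prod_(p <- L) p)%N.
  apply: (@leq_trans (M ^ size L)).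
    by rewrite leq_pexp2l // size_drop; lia.
  rewrite -iter_muln_1 -(count_predT L) -big_const_seq.
  rewrite big_seq [X in (_ <= X)%N]big_seq; apply: leq_prod => p; exact: Mle.
have : (\prod_(p <- ps) p <= n)%N.
  apply: dvdn_leq n_gt0 _; apply: dvdn_prod_primes; rewrite ?primes_uniq //.
    by apply/allP.
  by apply/allP => p; rewrite mem_primes => /and3P[].
rewrite -s_cat_L big_cat /= -/e; apply: leq_trans; rewrite expnS leq_mul2l.
apply/orP; right; apply: leq_trans ML; rewrite mulnC expnM.
by rewrite leq_exp2r.
Qed.

Lemma sum_inv_tail_le : \sum_(p <- L) p%:R^-1 <= 445 / 1000 :> rat.
Proof.
apply: le_trans (sum_wheel_inv_le k14).
have LE : L = [seq nth 0%N ps i | i <- index_iota k (size ps)].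
  apply: (@eq_from_nth _ 0%N); first by rewrite size_drop size_map size_iota.
  move=> i; rewrite size_drop => lti; rewrite nth_drop.
  by rewrite (nth_map 0%N) ?size_iota // nth_iota.
rewrite LE big_map.
rewrite (@big_cat_nat _ _ _ (size ps) k (5 * k + 4)) //=; last by lia.
apply: (@le_trans _ _ (\sum_(k <= i < size ps) wheel_inv i)).
  apply: ler_sum_nat => i /andP[ki lti].
  have := nth_primes_wheel lti; rewrite -(ler_nat rat) natrM natrD natrM -[i.+1%:R]natr1.
  rewrite wheel_invE; last by lia.
  have : 14 <= i%:R :> rat by rewrite (ler_nat _ 14) (leq_trans k14).
  move: (nth _ _ _)%:R i%:R => x y y14 h.
  have d0 : 0 < 35 * y - 117 by lra.
  have x0 : 0 < x by lra.
  by rewrite (ler_pdivlMr _ _ d0) mulrC (ler_pdivrMr _ _ x0); lra.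
by rewrite lerDl; apply: sumr_ge0 => i _; exact: wheel_inv_ge0.
Qed.

Lemma nth_primes_ge2 i : (i < size ps)%N -> (i + 2 <= nth 0%N ps i)%N.
Proof.
move=> lti; have [->|i_gt0] := posnP i.
  by apply/prime_gt1/nth_ps_prime; lia.
by have := nth_primes_half lti; lia.
Qed.

(** Since the i-th prime is at least i + 2, the product of the 1 - 1/p is at least the telescoping
    product of the (i + 1)/(i + 2), which is 1/(k + 1). *)
Lemma prod_primes_le_totient : (e <= totient e * k.+1)%N.
Proof.
rewrite totient_prod_primes // /e /s; elim: k lekN => [|j IHj] ltj.
  by rewrite take0 !big_nil.
rewrite (take_nth 0%N) // -cats1 !big_cat !big_seq1.
have := IHj (ltnW ltj); have := nth_primes_ge2 ltj.
move: (\prod_(p <- _) p)%N (\prod_(p <- _) p.-1)%N (nth _ _ _) => a b p lep leab.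
have lepp : (j.+1 * p <= p.-1 * j.+2)%N by case: p lep => [|p] lep; [lia | rewrite -pred_Sn; nia].
apply: leq_trans (leq_mul leab (leqnn p)) _; rewrite -!mulnA.
by rewrite leq_mul2l lepp orbT.
Qed.

(** The base case replaces the primes by 2, 3, 5, 7, 9, ..., 27; 14 is the first [k] for which these
    lower bounds suffice. *)
Lemma error_factor_le : (1000 * (5 * k%:R + 4) * (k%:R + 1) ^+ 2) ^+ 2 <= e%:R :> rat.
Proof.
have [j kE] : exists j, k = (14 + j)%N by exists (k - 14)%N; rewrite subnKC.
rewrite /e /s; move: lekN; rewrite kE; elim: j {kE} => [|j IHj] ltj.
  have -> : take 14 ps = [seq nth 0%N ps i | i <- iota 0 14].
    apply: (@eq_from_nth _ 0%N); first by rewrite size_takel // size_map size_iota.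
    move=> i; rewrite size_takel // => lti; rewrite nth_take //.
    by rewrite (nth_map 0%N) ?size_iota // nth_iota.
  rewrite big_map natr_prod.
  apply: (@le_trans _ _ (\prod_(i <- iota 0 14) (2 * i + (i == 0) + 1)%N%:R)).
    by rewrite !big_cons big_nil /=; lra.
  rewrite big_seq [X in _ <= X]big_seq; apply: ler_prod => i.
  rewrite mem_iota => /andP[_ lti]; rewrite ler0n ler_nat /=.
  have ltip := leq_trans lti ltj.
  by case: i lti ltip => [|i] lti ltip;
    [have := nth_primes_ge2 ltip | have := nth_primes_half ltip]; lia.
rewrite addnS in ltj *; move: (14 + j)%N (leq_addr j 14) IHj ltj => m m14 IHm ltm.
rewrite (take_nth 0%N ltm) -cats1 big_cat big_seq1 natrM -[m.+1%:R]natr1.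
have := nth_primes_half ltm; rewrite -(ler_nat rat) natrD natrM.
have := IHm (ltnW ltm); have : 14 <= m%:R :> rat by rewrite (ler_nat _ 14).
exact: error_factor_step.
Qed.

Let e_sqr_le : (e * e <= R)%N.
Proof.
rewrite leqNgt; apply/negP => ltRe; have := ltR; rewrite ltnNge => /negP; apply.
apply: leq_trans (leqW pow5_prod_primes_le).
apply: (@leq_trans (e ^ 4)); last by rewrite leq_pexp2l.
by rewrite (expnM e 2 2) leq_exp2r // -mulnn.
Qed.

Let e_lt_q : (e < q)%N.
Proof.
rewrite -(@ltn_exp2r e q 4) //; apply: leq_ltn_trans leq4.
by apply: (leq_trans _ pow5_prod_primes_le); rewrite leq_pexp2l.
Qed.

(** After squaring: [K ^ 2 * e ^ 4 <= e ^ 5 <= n] and [R ^ 2 <= n + 1]. *)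
Lemma sieve_error_le (K : rat) : 0 <= K -> K ^+ 2 <= e%:R ->
  K * e%:R ^+ 2 * R%:R <= n.+1%:R.
Proof.
move=> K0 leK; rewrite -(ler_pXn2r (n := 2)) ?nnegrE ?mulr_ge0 ?exprn_ge0 ?ler0n //.
have -> : (K * e%:R ^+ 2 * R%:R) ^+ 2 = K ^+ 2 * e%:R ^+ 4 * R%:R ^+ 2 by ring.
have -> : n.+1%:R ^+ 2 = n.+1%:R * n.+1%:R :> rat by rewrite expr2.
apply: ler_pM; rewrite ?mulr_ge0 ?exprn_ge0 ?ler0n //.
  apply: (@le_trans _ _ (e%:R * e%:R ^+ 4)); first by rewrite ler_wpM2r ?exprn_ge0 ?ler0n.
  by rewrite -exprS -natrX ler_nat leqW // pow5_prod_primes_le.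
by rewrite -natrX ler_nat.
Qed.

Lemma sieve_exists_fifth : sieve_exists n R q.
Proof.
exists e, L; split.
  apply: sieve_admissible_prod => //; first by rewrite s_cat_L primes_uniq.
  by move=> p; rewrite s_cat_L.
have e5 := pow5_prod_primes_le.
have phi_ge := prod_primes_le_totient.
have phi_le : (totient e <= e)%N.
  rewrite totient_count_coprime big_mkord -[X in (_ <= X)%N]card_ord -sum1_card.
  by apply: leq_sum => i _; case: coprime.
apply: (@sieve_bound_margin _ k%:R _ _ n.+1%:R e%:R (totient e)%:R (size L)%:R R%:R
  (\sum_(l <- L) l%:R^-1) q%:R _ erefl erefl).
- by rewrite (ler_nat _ 14).
- by rewrite ltr0n.
- by rewrite ler0n.
- exact: error_factor_le.
- by rewrite ler_nat leqW // (leq_trans _ e5) // -{1}[e]expn1 leq_pexp2l.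
- by rewrite ler_nat ltnW.
- apply: (sieve_error_le _ error_factor_le).
  have k0 := ler0n rat k; apply: mulr_ge0; last exact: sqr_ge0.
  by move: k%:R k0 => x x0; lra.
- by rewrite ler0n.
- by rewrite ler_nat.
- by rewrite natr1 -natrM ler_nat.
- by rewrite ler0n.
- by rewrite -(natrM _ 4) -natrD ler_nat size_drop; move: ltk lek; rewrite -/ps; lia.
- exact: sum_inv_tail_le.
Qed.

End ManyPrimes.

(** The threshold is 5 * 14, as the estimates for the [k] smallest primes start at [k = 14]; failure
    at the last cutoff gives more than the 69 primes between 31 and 409. *)
Lemma sieve_exists_many_primes (n R q : nat) : (0 < n)%N -> (R ^ 2 <= n.+1)%N ->
  (n.+1 < R.+1 ^ 2)%N -> (n.+1 <= q ^ 4)%N -> (70 <= size (primes n))%N ->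
  sieve_exists n R q.
Proof.
move=> n_gt0 leR ltR leq4 N70; pose k := (size (primes n) %/ 5)%N.
apply: (@sieve_exists_fifth n R q k) => //.
- by rewrite /k leq_divRL.
- by rewrite mulnC leq_divM.
- by rewrite -mulnSr mulnC ltn_ceil.
Qed.

(* If treating the primes up to [y] exactly fails, then [n] has more large prime
   divisors than there are primes in (y, z], which makes [R] large enough for
   the next cutoff, and finally [n] has at least 70 prime divisors. *)
Lemma sieve_exists_big (n R q : nat) : (R ^ 2 <= n.+1)%N -> (n.+1 < R.+1 ^ 2)%N ->
  (n.+1 <= q ^ 4)%N -> 1271 * 10 ^+ 5 < q%:R :> rat ->
  94 * 10 ^+ 12 <= R%:R :> rat -> sieve_exists n R q.
Proof.
move=> leR ltR leq4 q_big R_big.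
have n_gt0 : (0 < n)%N.
  have : 1 < n.+1%:R :> rat.
    apply: (@lt_le_trans _ _ (R%:R ^+ 2)); first by nra.
    by rewrite -natrX ler_nat.
  by rewrite (ltr_nat _ 1).
have sqr_le : R%:R ^+ 2 <= n.+1%:R :> rat by rewrite -natrX ler_nat.
have [//|[prod1 _]] := cutoff_step (y := 13) (z := 103) isT n_gt0 leR q_big
  (cutoff_numeric_13 R_big sqr_le).
have R_big2 : 9 * 10 ^+ 18 <= R%:R :> rat.
  rewrite -[9 * 10 ^+ 18]/(9%:R * 10%:R ^+ 18) -natrX -natrM; apply: leq_sqrt_floor ltR _.
  rewrite natrM natrX -[n.+1%:R]natr1; move: prod1; rewrite primes_between_13_103 !big_cons big_nil.
  by move: n%:R => x; clear; lra.
have [//|[prod2 _]] := cutoff_step (y := 19) (z := 163) isT n_gt0 leR q_big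
  (cutoff_numeric_19 R_big2 sqr_le).
have R_big3 : 31 * 10 ^+ 28 <= R%:R :> rat.
  rewrite -[31 * 10 ^+ 28]/(31%:R * 10%:R ^+ 28) -natrX -natrM; apply: leq_sqrt_floor ltR _.
  rewrite natrM natrX -[n.+1%:R]natr1; move: prod2; rewrite primes_between_19_163 !big_cons big_nil.
  by move: n%:R => x; clear; lra.
have [//|[_ ]] := cutoff_step (y := 31) (z := 409) isT n_gt0 leR q_big
  (cutoff_numeric_31 R_big3 sqr_le).
rewrite primes_between_31_409; exact: sieve_exists_many_primes.
Qed.

(** * Counting primitive values of the quadratic *)

Section PrimitiveValues.
Variables (K : finFieldType) (a b c : K).
Let f : {poly K} := a *: 'X^2 + b *: 'X + c%:P.
Hypotheses (a0 : a != 0) (disc : b ^+ 2 != 4%:R * a * c).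

Lemma card_quadratic_preimage (S : {set K}) : (#|[set x | f.[x] \in S]| <= 2 * #|S|)%N.
Proof.
rewrite -sum1_card (partition_big (fun x => f.[x]) [in S]) /=; last by move=> x; rewrite inE.
rewrite mulnC -sum_nat_const; apply: leq_sum => y yS.
rewrite sum1_card cardE.
have szf : size (f - y%:P) = 3%N.
  rewrite /f -!addrA size_polyDl ?size_scale ?size_polyXn //.
  apply: leq_ltn_trans (size_polyD _ _) _; rewrite gtn_max.
  rewrite (leq_ltn_trans (size_scale_leq _ _)) ?size_polyX //.
  by rewrite -polyCB (leq_ltn_trans (size_polyC_leq1 _)).
have f0 : f - y%:P != 0 by rewrite -size_poly_eq0 szf.
rewrite -ltnS -[X in (_ < X)%N]szf; apply: max_poly_roots => //; last exact: enum_uniq.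
apply/allP => x; rewrite mem_enum unfold_in => /andP[_ /eqP fx].
by rewrite /root hornerD hornerN hornerC fx subrr.
Qed.

Variable e : K.
Hypothesis eP : #|K|.-1.-primitive_root e.
Let n := #|K|.-1.
Local Notation lg := (discrete_log e).

Let n_gt0 : (0 < n)%N. Proof. exact: prim_order_gt0 eP. Qed.
Let nE : #|K| = n.+1. Proof. by rewrite prednK // ltnW // finNzRing_gt1. Qed.

Lemma card_dvd_discrete_log l : (l %| n)%N ->
  (#|[set y : K | (y != 0)%R && (l %| lg y)%N]| * l <= n)%N.
Proof.
move=> ln; have l_gt0 := dvdn_gt0 n_gt0 ln.
rewrite -[X in (_ <= X)%N](divnK ln) leq_mul2r; apply/orP; right.
have lt y : (lg y %/ l < n %/ l)%N by rewrite ltn_divLR // divnK // ltn_discrete_log.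
pose g y := Ordinal (lt y).
rewrite -[X in (_ <= X)%N]card_ord -(card_in_imset (f := g)) ?max_card //.
move=> x y; rewrite !inE => /andP[x0 lx] /andP[y0 ly] /(congr1 val) /= xy.
by rewrite -(discrete_logK eP x0) -(discrete_logK eP y0) -(divnK lx) xy divnK.
Qed.

Lemma primitive_values_count (R q : nat) : (1000 <= R)%N ->
  (R ^ 2 <= #|K|)%N -> (#|K| < R.+1 ^ 2)%N -> sieve_exists n R q ->
  12 * #|K|%:R / q%:R <
    #|[set x : K | [&& x != 0, f.[x] != 0, coprime n (lg x) & coprime n (lg f.[x])]]|%:R :> rat.
Proof.
move=> R1000 leR ltR [d [L [admissible bound]]].
rewrite nE; apply: lt_le_trans bound _.
pose X := [set x | (x != 0) && (f.[x] != 0)].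
have := @coprime_sieve K lg (fun x => lg f.[x]) X n R _ _ _ _ _ R1000 _ d L admissible.
have -> : [set x | [&& x != 0, f.[x] != 0, coprime n (lg x) & coprime n (lg f.[x])]] =
   [set x in X | coprime n (lg x) && coprime n (lg f.[x])].
  by apply/setP => x; rewrite !inE -!andbA.
apply => //; last by rewrite -nE.
- have := cardsC X; rewrite nE => XE.
  have : (#|~: X| <= #|[set (0 : K)%R] :|: [set x | f.[x] \in [set 0%R]]|)%N.
    apply/subset_leq_card/subsetP => x; rewrite !inE.
    by case: (x == 0); case: (f.[x] == 0).
  have := card_quadratic_preimage [set 0].
  have := (leq_card_setU [set (0 : K)] [set x | f.[x] \in [set 0]]).1.
  move=> h1 h2 h3; have := leq_trans h3 (leq_trans h1 (leq_add (leqnn _) h2)).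
  by rewrite !cards1 => h; rewrite -ltnS -XE -addnS leq_add2l.
- move=> d1 d2 a1 a2 d1n d2n leR'.
  have := @log_class_bound K e eP a b c d1 d2 a1 a2 R a0 disc d1n d2n leR' R1000 leR ltR.
  rewrite -/f nE; apply: leq_trans; rewrite leq_mul2r; apply/orP; right.
  by apply/subset_leq_card/subsetP => x; rewrite !inE -!andbA.
- move=> l ln; apply: leq_trans (card_dvd_discrete_log ln).
  rewrite leq_mul2r; apply/orP; right; apply/subset_leq_card/subsetP => x.
  by rewrite !inE => /andP[/andP[-> _] ->].
move=> l ln; apply: (@leq_trans (2 * (#|[set y : K | (y != 0)%R && (l %| lg y)%N]| * l))).
  rewrite mulnA leq_mul2r; apply/orP; right.
  apply: leq_trans (card_quadratic_preimage _); apply/subset_leq_card/subsetP => x.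
  by rewrite !inE => /andP[/andP[_ ->] ->].
by rewrite leq_mul2l card_dvd_discrete_log.
Qed.

End PrimitiveValues.

(** * Avoiding the hyperplanes and conclusion *)

Lemma sqrt_floor_exists N : exists R, (R ^ 2 <= N)%N /\ (N < R.+1 ^ 2)%N.
Proof.
elim: N => [|N [R [leR ltR]]]; first by exists 0%N.
have [lt|le] := ltnP N.+1 (R.+1 ^ 2); first by exists R; split=> //; apply: leqW.
by exists R.+1; split=> //; apply: leq_ltn_trans ltR _; rewrite ltn_exp2r.
Qed.

Lemma exists_primitive_root (K : finFieldType) :
  exists2 e : K, #|K|.-1.-primitive_root e &
    forall i, coprime #|K|.-1 i -> primitive_element (e ^+ i).
Proof.
have /cyclicP[u uT] := field_unit_group_cyclic [set: {unit K}]%G.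
have ou : #[u]%g = #|K|.-1 by rewrite -card_finField_unit orderE -uT.
exists (FinRing.uval u).
  rewrite /primitive_root_of_unity -ou order_gt0 /=; apply/forallP => i.
  apply/eqP; rewrite unity_rootE -FinRing.val_unitX.
  have -> : (FinRing.uval (u ^+ i.+1)%g == 1) = ((u ^+ i.+1)%g == 1%g).
    by rewrite -val_eqE.
  rewrite -order_dvdn; apply/idP/eqP => [|->]; last exact: dvdnn.
  by move/(dvdn_leq (ltn0Sn i)) => le; apply/eqP; rewrite eqn_leq le andbT ltn_ord.
move=> i co; exists (u ^+ i)%g; first by rewrite FinRing.val_unitX.
by rewrite /= uT generator_coprime ou.
Qed.

Lemma card_finvect (F : finFieldType) (L : fieldExtType F) :
  #|finvect_type L| = (#|F| ^ \dim {:L})%N.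
Proof.
pose V := Vector.class L.
by rewrite -(@card_vspacef F (finvect_type L) V) (@card_vspace F (finvect_type L) V).
Qed.

(** Overwriting the fixed coordinate [j] by an arbitrary scalar is an injection into all coordinate
    vectors. *)
Lemma card_affine_hyperplane (F : finFieldType) (L : fieldExtType F) (m : nat)
    (beta : m.-tuple L) (c : 'I_m -> F) (j : 'I_m) :
  (#|affine_hyperplane beta c j| * #|F| <= #|F| ^ m)%N.
Proof.
apply: (@leq_trans (#|[set u : {ffun 'I_m -> F} | u j == c j]| * #|F|)).
  by rewrite leq_mul2r leq_imset_card orbT.
rewrite -[X in (_ * X)%N]cardsT -cardsX.
pose g (ua : {ffun 'I_m -> F} * F) := [ffun i => if i == j then ua.2 else ua.1 i].
rewrite -[X in (_ <= _ ^ X)%N](card_ord m) -card_ffun -(card_in_imset (f := g)) ?max_card //.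
move=> [u x] [v y]; rewrite !inE !andbT /= => /eqP uj /eqP vj /ffunP guv.
congr (_, _); last by have := guv j; rewrite !ffunE eqxx.
apply/ffunP => i; have := guv i; rewrite !ffunE /=.
by case: eqP => [->|//]; rewrite uj vj.
Qed.

(** Each hyperplane excludes at most Q / q values of [x] directly and at most twice that through
    [f], which is at most two-to-one. With m <= 4 the factor [3 * m] is at most the 12 of
    [sieve_exists]. *)
Lemma card_bad_pairs (F : finFieldType) (L : fieldExtType F) (m : nat)
    (A : 'I_m -> {set finvect_type L}) (a b c : finvect_type L) :
  let f := a *: 'X^2 + b *: 'X + c%:P in
  a != 0 -> hyperplanes_in_general_position A ->
  (#|[set x | (x \notin Sc_star A) || (f.[x] \notin Sc_star A)]| * #|F|
    <= 3 * m * #|F| ^ m)%N.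
Proof.
move=> f a0 [beta [cc [_ AE]]].
have cardA i : (#|A i| * #|F| <= #|F| ^ m)%N by rewrite AE card_affine_hyperplane.
pose B i := A i :|: [set x | f.[x] \in A i].
have cardB i : (#|B i| * #|F| <= 3 * #|F| ^ m)%N.
  have h := leq_trans (leq_card_setU _ _).1
    (leq_add (leqnn #|A i|) (card_quadratic_preimage b c a0 (A i))).
  apply: leq_trans (leq_mul h (leqnn _)) _.
  by rewrite -mulSn -mulnA leq_mul2l cardA orbT.
have sub : [set x | (x \notin Sc_star A) || (f.[x] \notin Sc_star A)] \subset \bigcup_i B i.
  apply/subsetP => x; rewrite !inE !negbK => /orP[] /bigcupP[i _ Ai];
    by apply/bigcupP; exists i => //; rewrite !inE Ai ?orbT.
have le_sum : (#|\bigcup_i B i| <= \sum_i #|B i|)%N.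
  elim/big_ind2: _ => [|X x Y y leX leY|//]; first by rewrite cards0.
  exact: leq_trans (leq_card_setU _ _).1 (leq_add leX leY).
apply: leq_trans (leq_mul (leq_trans (subset_leq_card sub) le_sum) (leqnn _)) _.
rewrite big_distrl /=; apply: (@leq_trans (\sum_(i < m) 3 * #|F| ^ m)).
  by apply: leq_sum.
by rewrite sum_nat_const card_ord mulnA (mulnC m).
Qed.

(** From here on the three cases are treated together: m = 4 dictates the bound on [q], and m = 2
    the bound on Q, hence the 94 * 10^12 for R. *)
Lemma field_size_bounds (q m : nat) :
  [\/ m = 2%N /\ (94718 * 10 ^ 9 < q)%N,
      m = 3%N /\ (6601 * 10 ^ 8 < q)%N
    | m = 4%N /\ (1271 * 10 ^ 5 < q)%N] ->
  [/\ (m <= 4)%N, 1271 * 10 ^+ 5 < q%:R :> rat &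
      (94 * 10 ^+ 12) ^+ 2 <= (q ^ m)%:R :> rat].
Proof.
have pow_le (b r : rat) (k : nat) : 0 <= b -> b < r -> b ^+ k <= r ^+ k.
  by move=> b0 br; apply: lerXn2r; rewrite ?nnegrE ?(ltW br) ?(le_trans b0 (ltW br)).
case=> -[-> ]; rewrite -(ltr_nat rat) natrM natrX natrX; move: q%:R => x h.
- split; [exact isT | lra |].
  apply: le_trans (pow_le (94 * 10 ^+ 12) x 2 _ _); lra.
- split; [exact isT | lra |].
  apply: le_trans (pow_le (6601 * 10 ^+ 8) x 3 _ _); lra.
- split; [exact isT | lra |].
  apply: le_trans (pow_le (1271 * 10 ^+ 5) x 4 _ _); lra.
Qed.

Theorem theorem1p5 (q m : nat) (F : finFieldType) (L : fieldExtType F)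
    (hq : #|F| = q) (hm : \dim {:L} = m) (hm2 : (2 <= m)%N)
    (A : 'I_m -> {set finvect_type L})
    (hA : hyperplanes_in_general_position A)
    (f : {poly finvect_type L}) (a b c : finvect_type L)
    (hf : f = a *: 'X^2 + b *: 'X + c%:P)
    (ha : a != 0) (hdisc : b ^+ 2 != 4%:R * a * c)
    (hqm : [\/ m = 2%N /\ (94718 * 10 ^ 9 < q)%N,
               m = 3%N /\ (6601 * 10 ^ 8 < q)%N
             | m = 4%N /\ (1271 * 10 ^ 5 < q)%N]) :
  exists alpha : finvect_type L, primitive_pair_in (Sc_star A) alpha f.[alpha].
Proof.
move: hqm.
have q_gt0 : (0 < q)%N by rewrite -hq (ltnW (finNzRing_gt1 _)).
have cardK : #|finvect_type L| = (q ^ m)%N by rewrite card_finvect hq hm.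
have [R [leR ltR]] := sqrt_floor_exists #|finvect_type L|.
have nE : (q ^ m = (q ^ m).-1.+1)%N by rewrite prednK // expn_gt0 q_gt0.
move/field_size_bounds => [le_m4 q_big Q_big].
have R_big : 94 * 10 ^+ 12 <= R%:R :> rat.
  rewrite -[94 * 10 ^+ 12]/(94%:R * 10%:R ^+ 12) -natrX -natrM.
  apply: (@leq_sqrt_floor (q ^ m).-1); first by rewrite -nE -cardK.
  rewrite natrM natrX -nE; exact: Q_big.
have R1000 : (1000 <= R)%N by rewrite -(ler_nat rat); move: R_big; move: R%:R => x; clear; lra.
have sieve : sieve_exists #|finvect_type L|.-1 R q.
  have leq4 := leq_pexp2l q_gt0 le_m4.
  rewrite cardK in leR ltR *; rewrite nE in leR ltR leq4.
  exact: sieve_exists_big leR ltR leq4 q_big R_big.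
clear q_big Q_big R_big.
have [e eP e_gen] := exists_primitive_root (finvect_type L).
have := primitive_values_count ha hdisc eP R1000 leR ltR sieve.
rewrite -hf; set G := [set x | _] => ltG.
have := card_bad_pairs b c ha hA; rewrite -hf hq; set Bad := [set x | _] => leBad.
have : exists2 x, x \in G & x \notin Bad.
  apply/subsetPn/negP => /subset_leq_card leGB.
  have : (#|G| * q <= 12 * q ^ m)%N.
    apply: leq_trans (leq_mul leGB (leqnn q)) (leq_trans leBad _).
    by rewrite leq_mul2r; apply/orP; right; lia.
  rewrite leqNgt => /negP; apply.
  move: ltG; rewrite ltr_pdivrMr ?ltr0n // -!natrM ltr_nat cardK.
  by [].
case=> x; rewrite !inE negb_or !negbK => /and4P[x0 fx0 cox cofx] /andP[xS fxS].
exists x; split=> //.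
- by rewrite -(discrete_logK eP x0); apply: e_gen.
- by rewrite -(discrete_logK eP fx0); apply: e_gen.
- by rewrite !inE.
- by rewrite !inE.
Qed.
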